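(* Let $\Omega\subset\mathbb{R}^d$ be a compact convex region with positive Lebesgue measure, let $V\subset C(\Omega)$, let $\Psi$ be the Matérn kernel on $\Omega$ with smoothness $\nu>0$, and let $f=\{f(g):g\in V\}$ be a mean-zero Gaussian process with covariance function $K(g,g')=\int_\Omega\int_\Omega g(\mathbf{x})g'(\mathbf{x}')\Psi(\mathbf{x},\mathbf{x}')\,d\mathbf{x}\,d\mathbf{x}'$, where $V\supseteq\mathcal{N}_\Psi(\Omega)$. Let $\mathbf{X}_n=\{\mathbf{x}_1,\dots,\mathbf{x}_n\}\subset\Omega$ and suppose the input functions are $g_j(\mathbf{x})=\Psi(\mathbf{x},\mathbf{x}_j)$, $\mathbf{x}\in\Omega$, $j=1,\dots,n$. Let $\hat f(g)=\mathbb{E}[f(g)\mid f(g_1),\dots,f(g_n)]$. (1) There exists a constant $C_3>0$ (independent of $n$, $\mathbf{X}_n$ and $g$) such that for all $g\in\mathcal{N}_\Psi(\Omega)$, $$\mathbb{E}\left(f(g)-\hat f(g)\right)^2\le C_3\|g\|_{\mathcal{N}_\Psi(\Omega)}^2\,h_{\mathbf{X}_n,\Omega}^{2\nu}.$$ (2) For quasi-uniform designs $\mathbf{X}_n$ (with a fixed quasi-uniformity constant $C'$), there exists a constant $C>0$ (independent of $n$) such that $h_{\mathbf{X}_n,\Omega}\le Cn^{-1/d}$; therefore there exists a constant $C_4>0$ (independent of $n$ and $g$) such that for all $g\in\mathcal{N}_\Psi(\Omega)$, $$\mathbb{E}\left(f(g)-\hat f(g)\right)^2\le C_4\|g\|_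{\mathcal{N}_\Psi(\Omega)}^2\,n^{-\frac{2\nu}{d}}.$$
   Context: The Matérn kernel with smoothness $\nu$ is $\Psi(\mathbf{x},\mathbf{x}')=\psi(\|\mathbf{x}-\mathbf{x}'\|_2)$ with $$\psi(r)=\frac{1}{\Gamma(\nu)2^{\nu-1}}(2\sqrt{\nu}\,r)^\nu B_\nu(2\sqrt{\nu}\,r)\ (r>0),\qquad \psi(0)=1,$$ where $B_\nu$ is the modified Bessel function of the second kind. $\mathcal{N}_\Psi(\Omega)$ is the reproducing kernel Hilbert space on $\Omega$ associated with $\Psi$. The fill distance of $\mathbf{X}_n$ is $h_{\mathbf{X}_n,\Omega}=\sup_{\mathbf{x}\in\Omega}\min_{\mathbf{x}_j\in\mathbf{X}_n}\|\mathbf{x}-\mathbf{x}_j\|_2$, and $q_{\mathbf{X}_n}=\min_{1\le j\ne k\le n}\|\mathbf{x}_j-\mathbf{x}_k\|_2/2$ (for $n\ge2$). A design $\mathbf{X}_n$ is called quasi-uniform (with constant $C'$) if $h_{\mathbf{X}_n,\Omega}/q_{\mathbf{X}_n}\le C'$. When the matrix $\mathbf{K}_n=(K(g_j,g_k))_{j,k}$ is invertible, $\hat f(g)=\mathbf{k}_n(g)^T\mathbf{K}_n^{-1}\mathbf{y}_n$ with $\mathbf{k}_n(g)=(K(g,g_1),\dots,K(g,g_n))^T$ and $\mathbf{y}_n=(f(g_1),\dots,f(g_n))^T$. *)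

(* Defs.v *)
From HB Require Import structures.
From mathcomp Require Import all_boot all_order all_algebra.
From mathcomp Require Import all_classical all_reals all_analysis.
Set Implicit Arguments.
Unset Strict Implicit.
Unset Printing Implicit Defensive.
Import Order.TTheory GRing.Theory Num.Theory.
Import numFieldNormedType.Exports.
Local Open Scope classical_set_scope.
Local Open Scope ring_scope.

Definition rV_display : measure_display. Proof. exact. Qed.

Section measurable_rV.
Context {R : realType} (n : nat).

(* Generated by the coordinates, as the library does for [n.-tuple T]; this is
   the Borel sigma-algebra. *)
Let coors : 'I_n -> 'rV[R]_n -> measurableTypeR R := fun i x => x ord0 i.

Let rV_set0 : g_sigma_preimage coors set0.
Proof. exact: sigma_algebra0. Qed.

Let rV_setC A : g_sigma_preimage coors A -> g_sigma_preimage coors (~` A).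
Proof. exact: sigma_algebraC. Qed.

Let rV_bigcup (F : _^nat) : (forall i, g_sigma_preimage coors (F i)) ->
  g_sigma_preimage coors (\bigcup_i (F i)).
Proof. exact: sigma_algebra_bigcup. Qed.

HB.instance Definition _ := @isMeasurable.Build rV_display
  'rV[R]_n (g_sigma_preimage coors) rV_set0 rV_setC rV_bigcup.

Lemma measurable_coor (i : 'I_n) :
  measurable_fun [set: 'rV[R]_n] (fun x : 'rV[R]_n => x ord0 i : measurableTypeR R).
Proof.
move=> _ Y mY; rewrite setTI; apply: sub_sigma_algebra => /=.
rewrite -bigcup_seq/=; exists i => /=; first by rewrite mem_index_enum.
by exists Y => //; rewrite setTI.
Qed.

Lemma measurable_fun_rVP d (T : measurableType d) (f : T -> 'rV[R]_n) :
  measurable_fun [set: T] f <->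
  forall i, measurable_fun [set: T] (fun t => f t ord0 i : measurableTypeR R).
Proof.
split=> [mf i|mf].
  exact: (measurableT_comp (measurable_coor i) mf).
move=> _ A; rewrite setTI.
suff: g_sigma_preimage coors `<=` [set A | measurable (f @^-1` A)] by exact.
apply: smallest_sub => [|B].
  split => /=.
  - by rewrite preimage_set0.
  - by move=> B mB; rewrite setTD preimage_setC; exact: measurableC.
  - by move=> F mF; rewrite preimage_bigcup; exact: bigcup_measurable.
rewrite -bigcup_seq/= => -[i _ [Y mY <-]].
by rewrite setTI; have := mf i measurableT _ mY; rewrite setTI.
Qed.

End measurable_rV.

Section lebesgue_rV.
Context {R : realType}.

Definition rV_cons n (p : measurableTypeR R * 'rV[R]_n) : 'rV[R]_n.+1 :=
  row_mx (\row_(j < 1) p.1) p.2.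

Definition rV_uncons n (x : 'rV[R]_n.+1) : measurableTypeR R * 'rV[R]_n :=
  (x ord0 ord0, \row_j x ord0 (lift ord0 j)).

Lemma rV_cons0 n p : @rV_cons n p ord0 ord0 = p.1.
Proof.
have -> : @ord0 n = lshift n (ord0 : 'I_1) by exact: val_inj.
by apply: etrans (row_mxEl _ _ _ _) _; rewrite mxE.
Qed.

Lemma rV_consS n p (i : 'I_n) : @rV_cons n p ord0 (lift ord0 i) = p.2 ord0 i.
Proof.
have -> : lift ord0 i = rshift 1 i by exact: val_inj.
exact: (row_mxEr _ _ _ _).
Qed.

Lemma rV_consK n : cancel (@rV_cons n) (@rV_uncons n).
Proof.
move=> [a x]; rewrite /rV_uncons rV_cons0 /=; congr pair.
by apply/rowP => j; rewrite mxE rV_consS.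
Qed.

Lemma measurable_rV_cons n : measurable_fun setT (@rV_cons n).
Proof.
apply/measurable_fun_rVP => i.
case: (unliftP ord0 i) => [k ->|->].
  rewrite (_ : (fun _ => _) = (fun x : 'rV[R]_n => x ord0 k : measurableTypeR R) \o snd).
    exact: (measurableT_comp (measurable_coor k) measurable_snd).
  by apply/funext => p /=; rewrite rV_consS.
rewrite (_ : (fun _ => _) = fst); first exact: measurable_fst.
by apply/funext => p; rewrite rV_cons0.
Qed.

Lemma measurable_rV_uncons n : measurable_fun setT (@rV_uncons n).
Proof.
apply/measurable_fun_pairP; split => /=; first exact: measurable_coor.
apply/measurable_fun_rVP => i.
rewrite (_ : (fun _ => _) =
  (fun x : 'rV[R]_n.+1 => x ord0 (lift ord0 i) : measurableTypeR R)).
  exact: measurable_coor.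
by apply/funext => x /=; rewrite mxE.
Qed.

Section step.
Context (n : nat) (mu : {sigma_finite_measure set 'rV[R]_n -> \bar R}).

Definition lebesgue_rV_step : set 'rV[R]_n.+1 -> \bar R :=
  pushforward (@lebesgue_measure R \x mu)%E (@rV_cons n).

Let step0 : lebesgue_rV_step set0 = 0%E.
Proof. by rewrite /lebesgue_rV_step /pushforward preimage_set0 measure0. Qed.

Let step_ge0 A : (0 <= lebesgue_rV_step A)%E.
Proof. by rewrite /lebesgue_rV_step /pushforward measure_ge0. Qed.

Let step_sigma_additive : semi_sigma_additive lebesgue_rV_step.
Proof.
move=> F mF tF mUF; rewrite /lebesgue_rV_step /pushforward preimage_bigcup.
have mpre A : measurable A -> measurable (@rV_cons n @^-1` A).
  by move=> mA; rewrite -[X in measurable X]setTI; exact: measurable_rV_cons.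
apply: measure_semi_sigma_additive.
- by move=> k; exact: mpre.
- by apply/trivIsetP => i j _ _ ij; rewrite -preimage_setI; move/trivIsetP : tF => -> //; rewrite preimage_set0.
- by rewrite -preimage_bigcup; exact: mpre.
Qed.

HB.instance Definition _ := isMeasure.Build _ _ _ lebesgue_rV_step
  step0 step_ge0 step_sigma_additive.

Let step_sigma_finite : sigma_finite setT lebesgue_rV_step.
Proof.
have /sigma_finiteP[F [TF ndF Foo]] := sigma_finiteT (@lebesgue_measure R).
have /sigma_finiteP[G [TG ndG Goo]] := sigma_finiteT mu.
exists (fun k => @rV_uncons n @^-1` (F k `*` G k)).
  apply/esym; rewrite -preimage_bigcup (_ : \bigcup_k _ = setT) ?preimage_setT //.
  apply/seteqP; split => // -[x y] _.
  have : setT x by []. have : setT y by [].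
  rewrite TF TG => -[k _ Gky] [j _ Fjx]; exists (maxn j k) => //; split => /=.
  - by move: x Fjx; exact/subsetPset/ndF/leq_maxl.
  - by move: y Gky; exact/subsetPset/ndG/leq_maxr.
move=> k; have [mFk Fkoo] := Foo k; have [mGk Gkoo] := Goo k; split.
  rewrite -[X in measurable X]setTI; apply: measurable_rV_uncons => //.
  exact: measurableX.
rewrite /lebesgue_rV_step /pushforward -comp_preimage.
rewrite (_ : _ \o _ = id) ?preimage_id; last first.
  by apply/funext => p /=; rewrite rV_consK.
by rewrite product_measure1E// lte_mul_pinfty// ge0_fin_numE.
Qed.

HB.instance Definition _ := Measure_isSigmaFinite.Build _ _ _ lebesgue_rV_step
  step_sigma_finite.

End step.
Fixpoint lebesgue_rV n : {sigma_finite_measure set 'rV[R]_n -> \bar R} :=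
  if n is m.+1 then lebesgue_rV_step (lebesgue_rV m) else dirac (0 : 'rV[R]_0).

Lemma lebesgue_rV_box n (a b : 'rV[R]_n) :
  (forall i, a ord0 i <= b ord0 i) ->
  lebesgue_rV n [set x | forall i, a ord0 i <= x ord0 i <= b ord0 i] =
  (\prod_i (b ord0 i - a ord0 i))%:E.
Proof.
elim: n => [|n IHn] in a b * => ab.
  rewrite /= big_ord0 diracE mem_set //=; by case.
rewrite big_ord_recl EFinM /= /lebesgue_rV_step /pushforward.
pose a' : 'rV[R]_n := \row_j a ord0 (lift ord0 j).
pose b' : 'rV[R]_n := \row_j b ord0 (lift ord0 j).
pose B := [set x : 'rV[R]_n | forall i, a' ord0 i <= x ord0 i <= b' ord0 i].
have mB : measurable B.
  rewrite (_ : B = \bigcap_(i in [set: 'I_n])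
    ((fun x : 'rV[R]_n => x ord0 i : measurableTypeR R) @^-1` `[a' ord0 i, b' ord0 i])).
    apply: fin_bigcap_measurable => // i _; rewrite -[X in measurable X]setTI.
    by apply: measurable_coor => //; exact: measurable_itv.
  apply/seteqP; split => x /= Hx i; first by move=> _ /=; rewrite in_itv/=; exact: Hx.
  by have := Hx i I; rewrite /= in_itv.
rewrite (_ : _ @^-1` _ = `[a ord0 ord0, b ord0 ord0] `*` B); last first.
  apply/seteqP; split => p /=.
    move=> H; split; first by have := H ord0; rewrite rV_cons0 /= in_itv.
    by move=> i; have := H (lift ord0 i); rewrite rV_consS !mxE.
  rewrite in_itv /= => -[H0 H] i.
  case: (unliftP ord0 i) => [k ->|->]; last by rewrite rV_cons0.
  by have := H k; rewrite rV_consS !mxE.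
rewrite product_measure1E //.
congr (_ * _)%E.
  apply: etrans (lebesgue_measure_itv _) _; rewrite /= lte_fin; case: ltP => // ba.
  by congr EFin; apply/esym/eqP; rewrite subr_eq0 eq_le ab ba.
rewrite IHn => [|i]; last by rewrite !mxE.
by congr EFin; apply: eq_bigr => i _; rewrite !mxE.
Qed.
End lebesgue_rV.

Section matern.
Context {R : realType}.

Definition gamma_fun (s : R) : R :=
  \int[lebesgue_measure]_(t in `]0, +oo[) (t `^ (s - 1) * expR (- t)).

Definition cosh (t : R) : R := (expR t + expR (- t)) / 2.

(* Modified Bessel function of the second kind, by its integral representation
   on z > 0 (also for integer nu, where the sine formula degenerates). *)
Definition besselK (nu z : R) : R :=
  \int[lebesgue_measure]_(t in `[0, +oo[) (expR (- z * cosh t) * cosh (nu * t)).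

Definition matern_radial (nu r : R) : R :=
  if r == 0 then 1 else
  let z := 2 * Num.sqrt nu * r in
  (gamma_fun nu * 2 `^ (nu - 1))^-1 * z `^ nu * besselK nu z.

(* The canonical norm on ['rV[R]_d] is the sup norm. *)
Definition norm2 d (x : 'rV[R]_d) : R := Num.sqrt (\sum_i x ord0 i ^+ 2).

Definition matern d (nu : R) (x y : 'rV[R]_d) : R :=
  matern_radial nu (norm2 (x - y)).

End matern.

(* A Hilbert space of real functions on [T], given by its carrier and its inner
   product (only meaningful on the carrier), with reproducing kernel [K]. It is
   unique by the Moore-Aronszajn theorem. *)
Record rkhs (R : realType) (T : Type) (K : T -> T -> R) := RKHS {
  rkhs_set : set (T -> R) ;
  rkhs_dot : (T -> R) -> (T -> R) -> R ;
  rkhs_zero : rkhs_set (fun=> 0) ;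
  rkhs_lin : forall (a : R) g h, rkhs_set g -> rkhs_set h ->
    rkhs_set (fun x => a * g x + h x) ;
  rkhs_dotC : forall g h, rkhs_set g -> rkhs_set h ->
    rkhs_dot g h = rkhs_dot h g ;
  rkhs_dot_lin : forall (a : R) g h k, rkhs_set g -> rkhs_set h -> rkhs_set k ->
    rkhs_dot (fun x => a * g x + h x) k = a * rkhs_dot g k + rkhs_dot h k ;
  rkhs_dot_gt0 : forall g, rkhs_set g -> g <> (fun=> 0) -> 0 < rkhs_dot g g ;
  rkhs_complete : forall u : nat -> T -> R, (forall n, rkhs_set (u n)) ->
    (forall e : R, 0 < e -> exists N, forall m n, (N <= m)%N -> (N <= n)%N ->
      Num.sqrt (rkhs_dot (u m \- u n) (u m \- u n)) < e) ->
    exists2 g, rkhs_set g &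
      Num.sqrt (rkhs_dot (u n \- g) (u n \- g)) @[n --> \oo] --> (0 : R) ;
  rkhs_kernel : forall x, rkhs_set (fun y => K y x) ;
  rkhs_reproducing : forall g x, rkhs_set g ->
    g x = rkhs_dot g (fun y => K y x) }.

Definition rkhs_norm (R : realType) (T : Type) (K : T -> T -> R) (H : rkhs K)
  (g : T -> R) : R := Num.sqrt (rkhs_dot H g g).

Section probability.
Context {d : measure_display} {T : measurableType d} {R : realType}.
Variable P : probability T R.

(* [normal_prob m 0] is a uniform law, not a point mass. *)
Definition gaussian_law (m s : R) (A : set (measurableTypeR R)) : \bar R :=
  if s == 0 then \d_m A else normal_prob m s A.

Definition gaussian_rv (X : T -> R) :=
  exists m s : R, forall A : set (measurableTypeR R), measurable A ->
    P (X @^-1` A) = gaussian_law m s A.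

(* A random vector is (possibly degenerate) Gaussian when all its linear
   combinations are. *)
Definition gaussian_process (I : Type) (V : set I) (f : I -> {RV P >-> R}) :=
  forall (k : nat) (i : 'I_k -> I) (a : 'I_k -> R), (forall j, V (i j)) ->
    gaussian_rv (fun w => \sum_j a j * f (i j) w).

Definition centered_gaussian_process (I : Type) (V : set I) (K : I -> I -> R)
    (f : I -> {RV P >-> R}) :=
  [/\ gaussian_process V f,
      forall g, V g -> ('E_P[f g] = 0)%E &
      forall g h, V g -> V h -> covariance P (f g) (f h) = (K g h)%:E].

(* [Z] is a version of E[X | Y_0, ..., Y_(n-1)]. *)
Definition cond_expectation (n : nat) (Y : 'I_n -> T -> R) (X Z : T -> R) :=
  [/\ P.-integrable setT (EFin \o Z),
      forall B : set R, measurable B -> g_sigma_preimage Y (Z @^-1` B) &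
      forall A, g_sigma_preimage Y A ->
        (\int[P]_(w in A) (Z w)%:E = \int[P]_(w in A) (X w)%:E)%E].

End probability.

Section design.
Context {R : realType} {d : nat} (Omega : set 'rV[R]_d).

(* Since 'I_n is finite, the infima over indices below are minima. *)
Definition fill_distance n (X : 'I_n -> Omega) : R :=
  sup [set inf [set norm2 (x - \val (X j)) | j in [set: 'I_n]] | x in Omega].

Definition separation_distance n (X : 'I_n -> Omega) : R :=
  inf [set norm2 (\val (X jk.1) - \val (X jk.2)) / 2
      | jk in [set jk : 'I_n * 'I_n | jk.1 != jk.2]].

(* Positivity of q is required since [h / 0 = 0] in Rocq. *)
Definition quasi_uniform (C' : R) n (X : 'I_n -> Omega) :=
  0 < separation_distance X /\ fill_distance X / separation_distance X <= C'.

Definition matern_on (nu : R) (x y : Omega) : R := matern nu (\val x) (\val y).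

(* [valL_ 0 g] extends [g : Omega -> R] by 0; its values off [Omega] are not
   used. *)
Definition matern_cov (nu : R) (g g' : Omega -> R) : R :=
  \int[lebesgue_rV d]_(x in Omega) \int[lebesgue_rV d]_(x' in Omega)
    (valL_ 0 g x * valL_ 0 g' x' * matern nu x x').

End design.

(* Main.v *)
(* The conditional expectation is the best mean square predictor, so the error is
   at most E(f(g) - sum_j a_j f(g_j))^2 for any coefficients a_j. With
   s = sum_j a_j g_j the orthogonal projection of g in the native space, this is
   K(e, e) for e = g - s, hence at most vol(Omega)^2 sup |e|^2. As e vanishes on
   the design, |e(x)|^2 is at most ||e||^2 times the quadratic form of the kernel in
   the coefficients of delta_x - sum_j u_j delta_(x_j), for any u_j. Choosing u_j
   by local polynomial reproduction from design points within O(h) of x, this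
   functional kills polynomials of low degree. The Matern kernel is a Gamma mixture
   of Gaussians, and for each Gaussian the Taylor remainder bounds the quadratic
   form; integrating these bounds over the mixture gives O(h^(2 nu)).
   For quasi-uniform designs h is O(n^(-1/d)) by the pigeonhole principle. *)
Require Import Defs.
From mathcomp Require Import all_boot all_order all_algebra.
From mathcomp Require Import all_classical all_reals all_analysis.
From mathcomp Require Import measurable_realfun ring lra.
Import Order.TTheory GRing.Theory Num.Theory.
Import numFieldNormedType.Exports.
Local Open Scope classical_set_scope.
Local Open Scope ring_scope.
Set Implicit Arguments.
Unset Strict Implicit.
Unset Printing Implicit Defensive.

(** The Matern kernel has limited smoothness on the diagonal, so Taylor's formula applied to it
    directly would not give the exponent $2\nu$; each Gaussian of the mixture is smooth. The
    Gaussian $\exp(-\nu e^{-v}r^2)$ has weight at most $e^{\nu v}$, and its quadratic form is at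
    most a constant times $\min(1,(h^2e^{-v})^m)$. For $m\ge 2\nu$ the product decays exponentially
    on both sides of $e^v=h^2$, where it equals $h^{2\nu}$: this is the origin of the rate, for all
    $\nu>0$ at once.

    Positive volume and convexity act through a single cube inside [Omega].

    Two degeneracies shape the rest. Design points may coincide, so no inverse kernel matrix appears
    and the projection comes from Gram-Schmidt. The conditional expectation is any integrable
    version, so its squared error could a priori be infinite; it is bounded in the extended reals,
    by truncation. *)

(** * Substitutions in integrals over the real line *)

Section real_integrals.
Context {R : realType}.
Local Notation mu := (@lebesgue_measure R).
Implicit Types nu r s t u v z a c : R.

Lemma ln_cvgy : @ln R x @[x --> +oo] --> +oo.
Proof.
apply/cvgryPge => A; near=> x.
have -> : A = ln (expR A) by rewrite expRK.
have x0 : 0 < x by near: x; exact: nbhs_pinfty_gt.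
by rewrite ler_ln ?posrE ?expR_gt0 //; near: x; exact: nbhs_pinfty_ge.
Unshelve. all: by end_near. Qed.

Lemma bigcup_itvy (u_ : R^nat) (D : set R) :
  (forall n x, u_ n <= x -> D x) -> (forall x, D x -> exists n, u_ n <= x) ->
  \bigcup_n [set` `[u_ n, +oo[] = D.
Proof.
move=> uD Du; apply/seteqP; split=> [x [n _]|x Dx] /=.
  by rewrite in_itv/= andbT; exact: uD.
by have [n un] := Du _ Dx; exists n => //=; rewrite in_itv/= andbT.
Qed.

Lemma exists_invS_le t : 0 < t -> exists n : nat, n.+1%:R^-1 <= t.
Proof.
move=> t0; exists (Num.truncn t^-1).
rewrite -[leRHS]invrK lef_pV2 ?posrE ?invr_gt0 //.
by apply/ltW; rewrite truncnS_gt.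
Qed.

(** The substitution by [ln] is made on the closed half-lines [[n.+1%:R^-1, +oo[]. These increase to
    the positive half-line and their images to the whole line, so monotone convergence gives the
    limit on both sides. *)
Lemma integral_exp_subst (G : R -> R) : continuous G -> (forall v, 0 <= G v) ->
  (\int[mu]_v (G v)%:E = \int[mu]_(t in `]0%R, +oo[) (G (ln t) / t)%:E)%E.
Proof.
move=> cG G0.
have n0 n : 0 < n.+1%:R^-1 :> R by rewrite invr_gt0.
have mono n m : (n <= m)%N -> m.+1%:R^-1 <= n.+1%:R^-1 :> R.
  by move=> nm; rewrite lef_pV2 ?posrE // ler_nat.
have dln x : 0 < x -> (@ln R)^`()%classic x = x^-1.
  by move=> x0; rewrite derive1E; apply: derive_val; exact: is_derive1_ln.
have sub n : (\int[mu]_(v in `[ln n.+1%:R^-1, +oo[) (G v)%:E =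
    \int[mu]_(t in `[(n.+1%:R^-1 : R)%R, +oo[) (G (ln t) / t)%:E)%E.
  rewrite (@increasing_ge0_integration_by_substitutiony _ (@ln R) G n.+1%:R^-1).
  - apply: eq_integral => t; rewrite inE /= in_itv/= andbT => nt.
    by rewrite /= !fctE dln // (lt_le_trans (n0 n)).
  - move=> x y; rewrite !in_itv/= !andbT => nx ny xy.
    by rewrite ltr_ln ?posrE // (lt_le_trans (n0 n)).
  - move=> x; rewrite in_itv/= andbT => nx.
    have x0 : 0 < x by apply: lt_trans nx.
    apply: (@cvg_trans _ ((fun x => x^-1) @ x)).
      apply: near_eq_cvg; near=> y; rewrite dln //.
      by near: y; exact: lt_nbhsr.
    rewrite dln //; apply: inv_continuous; exact: lt0r_neq0.
  - apply/cvg_ex; exists (n.+1%:R^-1)^-1; apply: (@cvg_trans _ ((fun x => x^-1) @ (n.+1%:R^-1)^'+)).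
      apply: near_eq_cvg; near=> y; rewrite dln //.
      by apply: (lt_trans (n0 n)); near: y; exact: nbhs_right_gt.
    apply: cvg_at_right_filter; apply: inv_continuous; exact: lt0r_neq0.
  - apply/cvg_ex; exists 0; apply: (@cvg_trans _ ((fun x => x^-1) @ +oo)).
      by apply: near_eq_cvg; near=> y; rewrite dln.
    apply/cvgr0Pnorm_lt => e e0; near=> x.
    have x0 : 0 < x by near: x; apply: nbhs_pinfty_gt; exact: num_real.
    rewrite normfV gtr0_norm // invf_plt ?posrE //.
    by near: x; apply: nbhs_pinfty_gt; exact: num_real.
  - split.
      move=> x; rewrite in_itv/= andbT => nx.
      by apply: ex_derive; apply: is_derive1_ln; exact: lt_trans nx.
    by apply: cvg_at_right_filter; apply: continuous_ln.
  - exact: ln_cvgy.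
  - exact: continuous_subspaceT.
  - by move=> x _.
have mG : measurable_fun [set: R] (fun v : R => (G v)%:E).
  by apply/measurable_EFinP; exact: continuous_measurable_fun.
have mGl : measurable_fun [set` `]0:R, +oo[] (fun t : R => (G (ln t) / t)%:E).
  apply/measurable_EFinP; apply: open_continuous_measurable_fun.
    exact: interval_open.
  move=> t; rewrite inE/= in_itv/= andbT => t0; apply: cvgM.
    by apply: (continuous_comp (f := @ln R)); [exact: continuous_ln|exact: cG].
  by apply: inv_continuous; exact: lt0r_neq0.
have L1 : (\int[mu]_(v in `[ln (n.+1%:R^-1), +oo[) (G v)%:E)%E @[n --> \oo] -->
    (\int[mu]_v (G v)%:E)%E.
  have <- : \bigcup_n [set` `[ln (n.+1%:R^-1 : R), +oo[] = [set: R].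
    apply: bigcup_itvy => // x _; have [n nx] := exists_invS_le (expR_gt0 x).
    by exists n; rewrite -[leRHS]expRK ler_ln ?posrE ?expR_gt0.
  apply: (@ge0_nondecreasing_set_cvg_integral _ (measurableTypeR R) R
    (fun n => [set` `[ln (n.+1%:R^-1 : R), +oo[]) (fun v : R => (G v)%:E) _) => //.
  - move=> n m nm; apply/subsetPset => x /=; rewrite !in_itv/= !andbT.
    by apply: le_trans; rewrite ler_ln ?posrE ?mono.
  - by move=> i; exact: measurable_funTS.
  - by move=> i x _; rewrite lee_fin.
have L2 : (\int[mu]_(v in `[ln (n.+1%:R^-1), +oo[) (G v)%:E)%E @[n --> \oo] -->
    (\int[mu]_(t in `]0%R, +oo[) (G (ln t) / t)%:E)%E.
  under eq_fun do rewrite sub.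
  have <- : \bigcup_n [set` `[n.+1%:R^-1 : R, +oo[] = [set` `]0:R, +oo[].
    apply: bigcup_itvy => [n x|x] /=; rewrite in_itv/= andbT.
      exact: lt_le_trans.
    by move=> /exists_invS_le.
  apply: (@ge0_nondecreasing_set_cvg_integral _ (measurableTypeR R) R
    (fun n => [set` `[n.+1%:R^-1 : R, +oo[]) (fun t : R => (G (ln t) / t)%:E) _) => //.
  - move=> n m nm; apply/subsetPset => x /=; rewrite !in_itv/= !andbT.
    exact/le_trans/mono.
  - move=> i; apply: measurable_funS mGl => // x /=; rewrite !in_itv/= !andbT.
    exact: lt_le_trans.
  - move=> i x /=; rewrite in_itv/= andbT => ix.
    by rewrite lee_fin divr_ge0 // ltW // (lt_le_trans (n0 i)).
exact: (cvg_unique _ L1 L2).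
Unshelve. all: by end_near. Qed.

Lemma integral_shift (G : R -> R) c : continuous G -> (forall v, 0 <= G v) ->
  (\int[mu]_v (G v)%:E = \int[mu]_v (G (v + c))%:E)%E.
Proof.
move=> cG G0.
have dF (x : R) : is_derive x 1 (fun v : R => v + c) (1 : R).
  by apply: is_derive_eq; rewrite addr0.
have dE : (fun v : R => v + c)^`()%classic = cst 1.
  by apply/funext => x; rewrite derive1E; apply: derive_val.
rewrite (@increasing_ge0_integration_by_substitutionT _ (fun v => v + c) G) //.
- by apply: eq_integral => x _; rewrite /= !fctE dE mulr1.
- by move=> x y xy; rewrite ltrD2r.
- by rewrite dE => x; exact: cvg_cst.
- by rewrite dE; exact: is_cvg_cst.
- by rewrite dE; exact: is_cvg_cst.
- apply/cvgrNyPle => A; near=> x; rewrite -lerBrDr; near: x; apply: nbhs_ninfty_le; exact: num_real.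
- apply/cvgryPge => A; near=> x; rewrite -lerBlDr; near: x; apply: nbhs_pinfty_ge; exact: num_real.
Unshelve. all: by end_near. Qed.

Lemma integral_symm (G : R -> R) : continuous G -> (forall v, 0 <= G v) ->
  (\int[mu]_v (G v)%:E = \int[mu]_(v in `[0%R, +oo[) (G v + G (- v))%:E)%E.
Proof.
move=> cG G0.
have mG : measurable_fun [set: R] (fun v : R => (G v)%:E).
  by apply/measurable_EFinP; exact: continuous_measurable_fun.
have mGN : measurable_fun [set: R] (fun v : R => (G (- v))%:E).
  apply/measurable_EFinP; apply: measurableT_comp => //.
  exact: continuous_measurable_fun.
under [RHS]eq_integral do rewrite EFinD.
rewrite ge0_integralD//=; last 4 first.
- by move=> x _; rewrite lee_fin.
- exact: measurable_funTS.
- by move=> x _; rewrite lee_fin.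
- exact: measurable_funTS.
rewrite [X in (_ + X)%E](ge0_integration_by_substitution0 (f := fun v => (G (- v))%:E))//=; last first.
  by move=> r; rewrite lee_fin.
under [X in (_ + X)%E]eq_integral do rewrite opprK.
rewrite -integral_itv_obnd_cbnd; last exact: measurable_funTS.
rewrite -ge0_integral_setU//=.
- congr integral; apply/seteqP; split => x //= _; rewrite !in_itv/= andbT.
  by case: (leP x 0) => h; [right|left].
- exact: measurable_funTS.
- by move=> x _; rewrite lee_fin.
- apply/disj_setPS => x [] /=; rewrite !in_itv/= andbT => h1 h2.
  by move: (lt_le_trans h1 h2); rewrite ltxx.
Qed.

Lemma continuous_expRB a (g : R -> R) : continuous g ->
  continuous (fun v => expR (a * v - g v)).
Proof.
move=> cg x; apply: (continuous_comp (f := fun v => a * v - g v)).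
  apply: cvgB; last exact: cg.
  by apply: cvgM; [exact: cvg_cst|exact: cvg_id].
exact: continuous_expR.
Qed.

(** The two-sided exponential is the dominating function for all integrals over the mixture, and its
    value yields the factor [2 / nu] in the final constant. *)
Lemma integral_expRNabs a : 0 < a ->
  (\int[mu]_v (expR (- (a * `|v|)))%:E = (2 / a)%:E)%E.
Proof.
move=> a0.
have cE : continuous (fun v => expR (- (a * `|v|))).
  move=> x; apply: (continuous_comp (f := fun v => - (a * `|v|))).
    apply: cvgN; apply: cvgM; [exact: cvg_cst|exact: norm_continuous].
  exact: continuous_expR.
rewrite integral_symm //.
transitivity (\int[mu]_(v in `[0%R, +oo[) (2 * expR (- (a * v)))%:E)%E.
  apply: eq_integral => x; rewrite inE/= in_itv/= andbT => x0.
  by rewrite normrN ger0_norm //; congr EFin; ring.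
have dF (x : R) : is_derive x 1 (fun v : R => - (2 / a) * expR (- (a * v))) (2 * expR (- (a * x))).
  apply: is_derive_eq; rewrite !/GRing.scale/=; field; exact: lt0r_neq0.
rewrite (@ge0_continuous_FTC2y _ _ (fun v => - (2 / a) * expR (- (a * v))) 0 0).
- by rewrite mulr0 oppr0 expR0 mulr1 sub0e -EFinN opprK.
- by move=> x _; rewrite mulr_ge0 ?expR_ge0.
- apply: continuous_subspaceT => x; apply: cvgM; first exact: cvg_cst.
  apply: (continuous_comp (f := fun v => - (a * v))); last exact: continuous_expR.
  by apply: cvgN; apply: cvgM; [exact: cvg_cst|exact: cvg_id].
- rewrite -[X in _ --> X](mulr0 (- (2 / a))); apply: cvgM; first exact: cvg_cst.
  apply: (@cvg_comp _ _ _ (fun v => a * v) (fun v => expR (- v)) +oo +oo); last exact: cvgr_expR.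
  by apply/gt0_cvgMry => //; exact: cvg_id.
- by move=> x _; apply: ex_derive.
- apply: cvg_at_right_filter.
  have /derivable1_diffP/differentiable_continuous := @ex_derive _ _ _ _ _ _ _ (dF 0).
  exact.
- by move=> x _; rewrite derive1E; apply: derive_val.
Qed.

End real_integrals.

(** * Polynomial approximation of the exponential *)

Section taylor.
Context {R : realType}.
Implicit Types s x : R.

Lemma le0_of_derive (f df : R -> R) : f 0 <= 0 ->
  (forall x, is_derive x 1 f (df x)) -> (forall x, 0 <= x -> df x <= 0) ->
  forall x, 0 <= x -> f x <= 0.
Proof.
move=> f0 fdf df0 x; rewrite le_eqVlt => /predU1P[<-//|x0].
have cf : {within `[0, x], continuous f}.
  apply: continuous_subspaceT => y; apply: differentiable_continuous.
  by apply/derivable1_diffP; have := fdf y => ?; apply: ex_derive.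
have [c + fc] := MVT x0 (fun y _ => fdf y) cf.
rewrite in_itv/= => /andP[c0 _].
apply: le_trans f0; rewrite -subr_le0 fc subr0.
by rewrite pmulr_lle0 // df0 // ltW.
Qed.

(** Integrating the approximation for [m] from 0 gives the one for [m.+1]: [q] below has derivative
    [- p] and value 1 at 0. The factor $1/m!$ of the Taylor remainder is given up. *)
Lemma expRN_poly (m : nat) : exists2 p : {poly R}, (size p <= m)%N &
  forall s, 0 <= s -> `|expR (- s) - p.[s]| <= s ^+ m.
Proof.
elim: m => [|m [p sp hp]].
  exists 0; first by rewrite size_poly0.
  move=> s s0; rewrite horner0 subr0 ger0_norm ?expR_ge0 // expr0.
  by rewrite -expR0 ler_expR oppr_le0.
pose q : {poly R} := 1 - \poly_(i < m.+1) (if i is k.+1 then p`_k / k.+1%:R else 0).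
have dq : q^`() = - p.
  rewrite derivB derivC sub0r; congr (- _); apply/polyP => i.
  rewrite coef_deriv coef_poly /=; case: ltnP => im.
    by rewrite -[LHS]mulr_natr divfK // pnatr_eq0.
  by rewrite mul0rn nth_default // (leq_trans sp).
have q0 : q.[0] = 1.
  rewrite horner_coef0 coefB coefC coef_poly /=; ring.
exists q.
  rewrite (leq_trans (size_polyD _ _)) // geq_max size_polyN size_poly andbT.
  by rewrite (leq_trans (size_polyC_leq1 _)).
have dE x : is_derive x 1 (fun x => q.[x]) (- p.[x]).
  by have := is_derive_poly q x; rewrite dq hornerN.
have dX (x : R) : is_derive x 1 (fun x => x ^+ m.+1) (m.+1%:R * x ^+ m).
  have := is_derive_poly ('X^(m.+1)) x; rewrite derivXn hornerMn hornerXn mulr_natl.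
  by rewrite (_ : horner _ = fun x => x ^+ m.+1) //; apply/funext => y; rewrite hornerXn.
(* Each one-sided estimate is a function vanishing at 0 whose derivative is nonpositive by the
   hypothesis on [p], since [x ^+ m <= m.+1%:R * x ^+ m]. *)
move=> s s0; rewrite ler_norml; apply/andP; split.
  rewrite -subr_le0.
  apply: (@le0_of_derive (fun s => - s ^+ m.+1 - (expR (- s) - q.[s]))
    (fun s => - (m.+1%:R * s ^+ m) + (expR (- s) - p.[s]))) => //.
  - by rewrite oppr0 expR0 q0 expr0n /=; lra.
  - move=> x; have := dE x => ?; have := dX x => ?.
    by apply: is_derive_eq; rewrite !/GRing.scale/=; ring.
  - move=> x x0; have := hp x x0; rewrite ler_norml => /andP[_ h].
    have xm : 0 <= x ^+ m by rewrite exprn_ge0.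
    have : x ^+ m <= m.+1%:R * x ^+ m by rewrite ler_peMl // ler1n.
    by lra.
rewrite -subr_le0.
apply: (@le0_of_derive (fun s => (expR (- s) - q.[s]) - s ^+ m.+1)
    (fun s => - (expR (- s) - p.[s]) - m.+1%:R * s ^+ m)) => //.
- by rewrite oppr0 expR0 q0 expr0n /=; lra.
- move=> x; have := dE x => ?; have := dX x => ?.
  by apply: is_derive_eq; rewrite !/GRing.scale/=; ring.
- move=> x x0; have := hp x x0; rewrite ler_norml => /andP[h _].
  have xm : 0 <= x ^+ m by rewrite exprn_ge0.
  have : x ^+ m <= m.+1%:R * x ^+ m by rewrite ler_peMl // ler1n.
  by lra.
Qed.

End taylor.

(** * Gaussian quadratic forms of functionals that kill polynomials *)

Section moments.
Context {R : realType} (d : nat) (J : finType).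
Variables (c : J -> R) (z : J -> 'rV[R]_d).

(* Products of univariate polynomials of degree less than [N] span the
   polynomials of degree less than [N] in each variable. *)
Definition kills (N : nat) :=
  forall p : 'I_d -> {poly R}, (forall i, (size (p i) <= N)%N) ->
    \sum_j c j * \prod_i (p i).[z j ord0 i] = 0.

Lemma norm2_sqr (x : 'rV[R]_d) : norm2 x ^+ 2 = \sum_i x ord0 i ^+ 2.
Proof. by rewrite sqr_sqrtr // sumr_ge0 // => i _; rewrite sqr_ge0. Qed.

(** Distributing the [k]-th power of the sum of squares gives one term for each map from the [k]
    factors to the coordinates. Its factors, grouped by the fibres of the map, form a product of
    univariate polynomials of degree at most [k.*2]. *)
Lemma kills_norm2 N k (y : 'rV[R]_d) : kills N -> (k.*2 < N)%N ->
  \sum_j c j * norm2 (z j - y) ^+ 2 ^+ k = 0.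
Proof.
move=> kN kl.
under eq_bigr => j _.
  rewrite norm2_sqr -[k in _ ^+ k]card_ord -prodr_const bigA_distr_bigA mulr_sumr.
  over.
rewrite exchange_big /= big1 // => f _.
pose p i : {poly R} := ('X - (y ord0 i)%:P) ^+ 2 ^+ #|[pred t | f t == i]|.
rewrite -[RHS](kN p) => [|i].
  apply: eq_bigr => j _; congr (_ * _).
  rewrite (partition_big f predT) //=; apply: eq_bigr => i _.
  rewrite /p !hornerE -prodr_const.
  by apply: eq_big => [t|t /eqP <-]; rewrite ?inE // !mxE.
rewrite /p -exprM size_exp_XsubC.
apply: leq_ltn_trans kl; rewrite mul2n leq_double.
by apply: leq_trans (max_card _) _; rewrite card_ord.
Qed.

Lemma kills_double N (y : 'rV[R]_d) (p : {poly R}) (a : R) :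
  kills N -> ((size p).*2 <= N.+1)%N ->
  \sum_j c j * p.[a * norm2 (z j - y) ^+ 2] = 0.
Proof.
move=> kN sp.
under eq_bigr => j _ do rewrite horner_coef mulr_sumr.
rewrite exchange_big /= big1 // => i _.
transitivity (p`_i * a ^+ i * \sum_j c j * norm2 (z j - y) ^+ 2 ^+ i).
  by rewrite mulr_sumr; apply: eq_bigr => j _; rewrite exprMn; ring.
rewrite (kills_norm2 _ kN) ?mulr0 //.
by rewrite -ltnS; apply: leq_trans sp; rewrite -doubleS leq_double.
Qed.

Lemma norm_double_sum (e : J -> J -> R) (M B : R) : \sum_j `|c j| <= M ->
  0 <= B -> (forall i j, `|e i j| <= B) ->
  `|\sum_i \sum_j c i * c j * e i j| <= M ^+ 2 * B.
Proof.
move=> cM B0 eB.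
have c0 : 0 <= \sum_j `|c j| by rewrite sumr_ge0.
apply: (@le_trans _ _ (\sum_i \sum_j `|c i| * `|c j| * B)).
  apply: le_trans (ler_norm_sum _ _ _) _; apply: ler_sum => i _.
  apply: le_trans (ler_norm_sum _ _ _) _; apply: ler_sum => j _.
  by rewrite !normrM ler_wpM2l // mulr_ge0.
apply: (@le_trans _ _ ((\sum_j `|c j|) ^+ 2 * B)).
  rewrite expr2 mulr_suml [leRHS]mulr_suml; apply: ler_sum => i _.
  by rewrite mulr_sumr mulr_suml.
by rewrite ler_wpM2r // lerXn2r // nnegrE // (le_trans c0).
Qed.

(** The bound 1 serves narrow Gaussians (large [a]), the power [(a * D) ^+ m] wide ones; the mixture
    contains both. *)
Lemma gauss_quad_bound (m : nat) (M D a : R) : kills m.*2 ->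
  \sum_j `|c j| <= M -> 0 <= a -> 0 <= D -> (forall i j, norm2 (z i - z j) ^+ 2 <= D) ->
  `|\sum_i \sum_j c i * c j * expR (- (a * norm2 (z i - z j) ^+ 2))| <=
    M ^+ 2 * Num.min 1 ((a * D) ^+ m).
Proof.
move=> km cM a0 D0 zD.
have aD0 : 0 <= a * D by rewrite mulr_ge0.
have s0 i j : 0 <= a * norm2 (z i - z j) ^+ 2 by rewrite mulr_ge0 ?sqr_ge0.
have [_|_] := leP 1 ((a * D) ^+ m).
  apply: norm_double_sum => // i j.
  by rewrite ger0_norm ?expR_ge0 // -expR0 ler_expR oppr_le0.
(* For fixed [j], [p.[a * norm2 (z i - z j) ^+ 2]] is a polynomial in [z i] of
   degree less than [m.*2], so it can be subtracted for free. *)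
have [p sp hp] := @expRN_poly R m.
have -> : \sum_i \sum_j c i * c j * expR (- (a * norm2 (z i - z j) ^+ 2)) =
  \sum_i \sum_j c i * c j * (expR (- (a * norm2 (z i - z j) ^+ 2)) -
    p.[a * norm2 (z i - z j) ^+ 2]).
  have H : \sum_i \sum_j c i * c j * p.[a * norm2 (z i - z j) ^+ 2] = 0.
    rewrite exchange_big big1 //= => j _.
    transitivity (c j * \sum_i c i * p.[a * norm2 (z i - z j) ^+ 2]).
      by rewrite mulr_sumr; apply: eq_bigr => i _; ring.
    by rewrite (kills_double _ _ km) ?mulr0 // leqW // leq_double.
  rewrite -[LHS]subr0 -[X in _ - X]H -sumrB; apply: eq_bigr => i _.
  by rewrite -sumrB; apply: eq_bigr => j _; ring.
apply: norm_double_sum => // [|i j]; first by rewrite exprn_ge0.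
by apply: le_trans (hp _ _) _ => //; rewrite lerXn2r // ?nnegrE // ler_wpM2l.
Qed.

End moments.

(** * The Matern kernel as a mixture of Gaussians *)

Section mixture.
Context {R : realType}.
Local Notation mu := (@lebesgue_measure R).
Implicit Types nu r s t u v z a c : R.

(* The integrand of the Gamma integral after the substitution [t = expR v]. *)
Definition log_gamma_weight nu v : R := expR (nu * v - expR v).
Local Notation w := log_gamma_weight.

Lemma continuous_log_gamma_weight nu : continuous (w nu).
Proof. by apply: continuous_expRB; exact: continuous_expR. Qed.

(** For negative [v] the factor [expR (nu * v)] decays by itself. Otherwise
    [expR v >= (1 + v / 2) ^+ 2], and completing the square in [2 * nu * v] produces
    [4 * nu ^+ 2]. *)
Lemma log_gamma_weight_le nu v : 0 < nu ->
  w nu v <= expR (4 * nu ^+ 2) * expR (- (nu * `|v|)).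
Proof.
move=> nu0; rewrite -expRD ler_expR.
have [v0|v0] := leP 0 v.
  rewrite ger0_norm //.
  have : (1 + v / 2) ^+ 2 <= expR v.
    rewrite [in leRHS](_ : v = v / 2 + v / 2); last by field.
    have h := expR_ge1Dx (v / 2).
    by rewrite expRD -expr2 lerXn2r ?nnegrE ?expR_ge0 // addr_ge0 // divr_ge0.
  by have := sqr_ge0 (v / 2 - 2 * nu); nra.
rewrite ltr0_norm //; have := expR_ge0 v; have := sqr_ge0 nu; nra.
Qed.

Lemma integrable_expRNabs a c : 0 < a ->
  mu.-integrable setT (fun v : R => (c * expR (- (a * `|v|)))%:E).
Proof.
move=> a0.
have -> : (fun v : R => (c * expR (- (a * `|v|)))%:E) =
    (fun v : R => c%:E * (expR (- (a * `|v|)))%:E)%E by [].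
apply: integrableZl => //; apply/integrableP; split.
  apply/measurable_EFinP; apply: measurableT_comp => //.
  apply: measurableT_comp => //; apply: measurable_funM => //.
under eq_integral do rewrite gee0_abs ?lee_fin ?expR_ge0 //.
by rewrite integral_expRNabs // ltry.
Qed.

Lemma integrable_log_gamma_weight nu (k : R -> R) : 0 < nu ->
  measurable_fun setT k -> (forall v, `|k v| <= 1) ->
  mu.-integrable setT (fun v : R => (w nu v * k v)%:E).
Proof.
move=> nu0 mk k1.
apply: (le_integrable _ _ _ (integrable_expRNabs (expR (4 * nu ^+ 2)) nu0)) => //.
  apply/measurable_EFinP; apply: measurable_funM => //.
  by apply: continuous_measurable_fun; exact: continuous_log_gamma_weight.
move=> v _; rewrite /= lee_fin normrM.
rewrite [X in _ <= X]ger0_norm ?mulr_ge0 ?expR_ge0 //.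
rewrite (ger0_norm (expR_ge0 _)).
apply: le_trans (log_gamma_weight_le v nu0).
by rewrite ler_piMr // expR_ge0.
Qed.

Lemma gamma_funE nu : 0 < nu ->
  gamma_fun nu = \int[mu]_v w nu v.
Proof.
move=> nu0; rewrite /gamma_fun /Rintegral integral_exp_subst; last 2 first.
- exact: continuous_log_gamma_weight.
- by move=> v; rewrite expR_ge0.
congr fine; apply: eq_integral => t; rewrite inE/= in_itv/= andbT => t0.
have -> : t^-1 = expR (- ln t) by rewrite expRN lnK ?posrE.
by rewrite /w lnK ?posrE // /powR gt_eqF // -!expRD; congr (expR _)%:E; ring.
Qed.

Lemma gamma_fun_gt0 nu : 0 < nu -> 0 < gamma_fun nu.
Proof.
move=> nu0; rewrite gamma_funE //.
have iw : mu.-integrable setT (fun v : R => (w nu v)%:E).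
  have := @integrable_log_gamma_weight nu (cst 1) nu0 (measurable_cst _).
  by under eq_fun do rewrite mulr1; apply=> v; rewrite normr1.
have mw : measurable_fun setT (fun v : R => (w nu v)%:E).
  by case/integrableP: iw.
(* A lower bound of the weight on [[0, 1]], where [nu * v >= 0] and [expR v <= expR 1]. *)
pose k : R := expR (- expR 1).
apply: (@lt_le_trans _ _ k); first exact: expR_gt0.
rewrite -lee_fin fineK; last exact: integrable_fin_num.
apply: (@le_trans _ _ (\int[mu]_(v in `[0%R, 1%R]) (w nu v)%:E)%E); last first.
  by apply: ge0_subset_integral => // v _; rewrite lee_fin expR_ge0.
apply: (@le_trans _ _ (\int[mu]_(v in `[0%R, 1%R]) k%:E)%E).
  rewrite integral_cst //= lebesgue_measure_itv /= lte_fin ltr01.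
  by rewrite -EFinB subr0 mule1.
apply: ge0_le_integral => //=.
- by move=> v _; rewrite lee_fin expR_ge0.
- by apply: measurable_funTS.
move=> v; rewrite in_itv/= => /andP[v0 v1].
rewrite lee_fin /k /log_gamma_weight ler_expR.
have : expR v <= expR 1 by rewrite ler_expR.
by have := mulr_ge0 (ltW nu0) v0; lra.
Qed.

(* The shift [v := v + ln (z / 2)] makes the exponent [z * cosh v]. *)
Lemma powR_besselK nu z : 0 < nu -> 0 < z -> z `^ nu * besselK nu z =
  2 `^ (nu - 1) * \int[mu]_v (w nu v * expR (- (z ^+ 2 / 4 * expR (- v)))).
Proof.
move=> nu0 z0; pose l := ln (z / 2).
have z20 : 0 < z / 2 by rewrite divr_gt0.
have el : expR l = z / 2 by rewrite lnK.
(* The factor [2^-1] is the one in [cosh (nu * v)], after the line is folded to a half-line;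
   [expR (- (nu * l))] compensates the shift in [expR (nu * v)]. *)
pose c0 := 2^-1 * expR (- (nu * l)).
pose k v := expR (- (z ^+ 2 / 4 * expR (- v))).
have ck : continuous k.
  move=> v; apply: (continuous_comp (f := fun v => - (z ^+ 2 / 4 * expR (- v)))); last exact: continuous_expR.
  apply: cvgN; apply: cvgM; first exact: cvg_cst.
  apply: (continuous_comp (f := -%R)); last exact: continuous_expR.
  exact: opp_continuous.
pose G v := c0 * (w nu v * k v).
have cG : continuous G.
  move=> v; apply: cvgM; first exact: cvg_cst.
  by apply: cvgM; [exact: continuous_log_gamma_weight|exact: ck].
have G0 v : 0 <= G v by rewrite !mulr_ge0 ?expR_ge0.
have GE v : G (v + l) = 2^-1 * (expR (- (z * cosh v)) * expR (nu * v)).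
  rewrite /G /c0 /w /k /cosh (expRD v) opprD (expRD (- v)) !expRN el.
  rewrite -!mulrA; congr (_ * _); rewrite -!expRN -!expRD; congr expR.
  by rewrite expRN; field; rewrite !lt0r_neq0 ?expR_gt0.
have bE : besselK nu z = \int[mu]_v G v.
  rewrite /besselK /Rintegral (integral_shift l cG G0) integral_symm.
  - congr fine; apply: eq_integral => v _; congr EFin; rewrite !GE /cosh opprK.
    by rewrite [expR (- v) + _]addrC mulNr mulrN; field.
  - move=> v; apply: (continuous_comp (f := fun v => v + l)); last exact: cG.
    by apply: cvgD; [exact: cvg_id|exact: cvg_cst].
  - by move=> v; exact: G0.
rewrite bE /G RintegralZl //; last first.
  apply: integrable_log_gamma_weight => //; first exact: continuous_measurable_fun.
  move=> v; rewrite ger0_norm ?expR_ge0 // -expR0 ler_expR oppr_le0.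
  by rewrite mulr_ge0 ?expR_ge0 // divr_ge0 // sqr_ge0.
rewrite mulrA; congr (_ * _).
rewrite /powR !gt_eqF // /c0 /l ln_div ?posrE //.
have -> : 2^-1 = expR (- ln 2) :> R by rewrite expRN lnK ?posrE.
by rewrite -!expRD; congr expR; ring.
Qed.

(** With $z=2\sqrt{\nu}\,r$ one has $z^2/4=\nu r^2$, so the kernel is the mean of $\exp(-\nu r^2/t)$
    for $t=e^v$ Gamma distributed with shape $\nu$. The separately defined value at 0 is the total
    mass 1 of this law. *)
Lemma matern_radialE nu r : 0 < nu -> 0 <= r -> matern_radial nu r =
  (gamma_fun nu)^-1 * \int[mu]_v (w nu v * expR (- (nu * expR (- v) * r ^+ 2))).
Proof.
move=> nu0; rewrite le_eqVlt => /predU1P[<-|r0].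
  rewrite /matern_radial eqxx.
  under eq_Rintegral do rewrite expr0n mulr0 oppr0 expR0 mulr1.
  by rewrite -gamma_funE // mulVf // lt0r_neq0 // gamma_fun_gt0.
have z0 : 0 < 2 * Num.sqrt nu * r by rewrite !mulr_gt0 // sqrtr_gt0.
rewrite /matern_radial gt_eqF //= -mulrA powR_besselK // invfM -[LHS]mulrA.
rewrite mulKf; last by rewrite lt0r_neq0 ?powR_gt0.
congr (_ * _); apply: eq_Rintegral => v _.
by rewrite !exprMn sqr_sqrtr ?ltW //; congr (_ * expR (- _)); field.
Qed.

Lemma Rintegral_sum d (T : measurableType d) (m : {measure set T -> \bar R})
    (D : set T) (I : Type) (s : seq I) (F : I -> T -> R) :
  measurable D -> (forall i, m.-integrable D (EFin \o F i)) ->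
  \int[m]_(x in D) (\sum_(i <- s) F i x) = \sum_(i <- s) \int[m]_(x in D) F i x.
Proof.
move=> mD iF; elim: s => [|i s IH].
  rewrite big_nil; under eq_Rintegral do rewrite big_nil.
  by rewrite Rintegral_cst // mul0r.
under eq_Rintegral do rewrite big_cons.
rewrite big_cons RintegralD ?IH //.
have -> : EFin \o (fun x => \sum_(j <- s) F j x) =
    (fun x => \sum_(j <- s) (EFin \o F j) x)%E.
  by apply/funext => x; rewrite /= sumEFin.
exact: integrable_sum.
Qed.

(** [eta] stands for the fill distance and [B] bounds the squared diameter of the nodes in units of
    [eta]; the constant is therefore independent of the scale. *)
Lemma matern_quad_bound (d : nat) (J : finType) (c : J -> R) (z : J -> 'rV[R]_d)
    (nu : R) (m : nat) (M B eta : R) :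
  0 < nu -> 2 * nu <= m%:R -> kills c z m.*2 -> \sum_j `|c j| <= M -> 0 <= B ->
  0 < eta -> (forall i j, norm2 (z i - z j) ^+ 2 <= B * eta ^+ 2) ->
  `|\sum_i \sum_j c i * c j * matern nu (z i) (z j)| <=
    (gamma_fun nu)^-1 * (M ^+ 2 * Num.max 1 ((nu * B) ^+ m) * (2 / nu)) *
    eta `^ (2 * nu).
Proof.
move=> nu0 num km cM B0 eta0 zB.
pose e i j v := expR (- (nu * expR (- v) * norm2 (z i - z j) ^+ 2)).
have e0 v : 0 <= nu * expR (- v) by rewrite mulr_ge0 ?expR_ge0 // ltW.
have me i j : measurable_fun setT (e i j).
  apply: measurableT_comp => //; apply: measurableT_comp => //.
  apply: measurable_funM => //; apply: measurable_funM => //.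
  exact: measurableT_comp.
have ie i j : mu.-integrable setT (fun v : R => (w nu v * e i j v)%:E).
  apply: integrable_log_gamma_weight => // v.
  rewrite ger0_norm ?expR_ge0 // -expR0 ler_expR oppr_le0.
  by rewrite mulr_ge0 // sqr_ge0.
have icc i j : mu.-integrable setT (fun v : R => (c i * c j * (w nu v * e i j v))%:E).
  have -> : (fun v : R => (c i * c j * (w nu v * e i j v))%:E) =
     (fun v : R => (c i * c j)%:E * (w nu v * e i j v)%:E)%E by [].
  exact: integrableZl.
pose F v := \sum_i \sum_j c i * c j * (w nu v * e i j v).
have FE v : F v = w nu v * \sum_i \sum_j c i * c j * e i j v.
  rewrite mulr_sumr; apply: eq_bigr => i _; rewrite mulr_sumr.
  by apply: eq_bigr => j _; ring.
have icc' i : mu.-integrable setT (fun v : R => (\sum_j c i * c j * (w nu v * e i j v))%:E).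
  have -> : (fun v : R => (\sum_j c i * c j * (w nu v * e i j v))%:E) =
      (fun v : R => \sum_j (c i * c j * (w nu v * e i j v))%:E)%E.
    by apply/funext => x; rewrite sumEFin.
  exact: integrable_sum.
have iF : mu.-integrable setT (fun v : R => (F v)%:E).
  have -> : (fun v : R => (F v)%:E) =
      (fun v : R => \sum_i (\sum_j c i * c j * (w nu v * e i j v))%:E)%E.
    by apply/funext => x; rewrite sumEFin.
  exact: integrable_sum.
have -> : \sum_i \sum_j c i * c j * matern nu (z i) (z j) =
    (gamma_fun nu)^-1 * \int[mu]_v F v.
  rewrite Rintegral_sum // mulr_sumr; apply: eq_bigr => i _.
  rewrite (Rintegral_sum _ _ (icc i)) // mulr_sumr; apply: eq_bigr => j _.
  have -> : matern nu (z i) (z j) = _ := matern_radialE nu0 (sqrtr_ge0 _).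
  by rewrite RintegralZl //; [rewrite mulrCA|exact: ie].
have g0 := gamma_fun_gt0 nu0.
rewrite normrM ger0_norm ?invr_ge0 ?(ltW g0) // -mulrA ler_pM2l ?invr_gt0 //.
(* Against the weight [expR (nu * v)], the factor [min 1 (expR (m * (l - v)))]
   decays on both sides of [v = l] because [2 * nu <= m]; the value at the peak
   is [expR (nu * l) = eta `^ (2 * nu)]. *)
pose l := ln (eta ^+ 2); pose L := M ^+ 2 * Num.max 1 ((nu * B) ^+ m).
have eta20 : 0 < eta ^+ 2 by rewrite exprn_gt0.
have el : expR l = eta ^+ 2 by rewrite lnK.
have L0 : 0 <= L by rewrite mulr_ge0 ?sqr_ge0 // le_max ler01.
pose b v := L * eta `^ (2 * nu) * expR (- (nu * `|v - l|)).
have Fb v : `|F v| <= b v.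
  rewrite FE normrM ger0_norm ?expR_ge0 //.
  have := gauss_quad_bound km cM (e0 v) _ zB.
  rewrite mulr_ge0 ?sqr_ge0 // => /(_ isT) q.
  apply: le_trans (ler_wpM2l (expR_ge0 _) q) _.
  have -> : nu * expR (- v) * (B * eta ^+ 2) = nu * B * expR (l - v).
    by rewrite expRD el; ring.
  have nuB : 0 <= nu * B by rewrite mulr_ge0 // ltW.
  (* The constant leaves the minimum at the price of [Num.max 1]; what remains depends on [v] only
     through [l - v]. *)
  have min_le : Num.min 1 ((nu * B * expR (l - v)) ^+ m) <=
      Num.max 1 ((nu * B) ^+ m) * Num.min 1 (expR (l - v) ^+ m).
    have X0 : 0 <= (nu * B) ^+ m by rewrite exprn_ge0.
    have Y0 : 0 <= expR (l - v) ^+ m by rewrite exprn_ge0 ?expR_ge0.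
    rewrite exprMn; set X := _ ^+ m in X0 *; set Y := _ ^+ m in Y0 *.
    have X1 : 1 <= Num.max 1 X by rewrite le_max lexx.
    have XX : X <= Num.max 1 X by rewrite le_max lexx orbT.
    have [Y1|Y1] := leP 1 Y.
      by rewrite mulr1 ge_min X1.
    by rewrite ge_min ler_wpM2r ?orbT.
  apply: le_trans (ler_wpM2l (expR_ge0 _) (ler_wpM2l (sqr_ge0 M) min_le)) _.
  rewrite [leLHS](_ : _ = L * (w nu v * Num.min 1 (expR (l - v) ^+ m))); last first.
    rewrite /L /log_gamma_weight.
    by set mx := Num.max _ _; set mn := Num.min _ (expR _ ^+ _); ring.
  rewrite /b -[leRHS]mulrA ler_wpM2l //.
  have -> : eta `^ (2 * nu) = expR (nu * l).
    by rewrite /powR gt_eqF // /l lnXn // ; congr expR; ring.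
  rewrite -expRM_natl -expRD -/(w nu v).
  have wle : w nu v <= expR (nu * v) by rewrite ler_expR gerBl ?expR_ge0.
  have min0 : 0 <= Num.min 1 (expR (m%:R * (l - v))).
    by rewrite le_min ler01 expR_ge0.
  apply: le_trans (ler_wpM2r min0 wle) _.
  have [vl|vl] := leP 0 (v - l).
    apply: (@le_trans _ _ (expR (nu * v) * expR (m%:R * (l - v)))).
      by rewrite ler_wpM2l ?expR_ge0 // ge_min lexx orbT.
    by rewrite ger0_norm // -expRD ler_expR; nra.
  apply: (@le_trans _ _ (expR (nu * v) * 1)).
    by rewrite ler_wpM2l ?expR_ge0 // ge_min lexx.
  by rewrite mulr1 ltr0_norm // ler_expR; lra.
have cb : continuous (fun v => expR (- (nu * `|v - l|))).
  move=> v; apply: (continuous_comp (f := fun v => - (nu * `|v - l|))); last exact: continuous_expR.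
  apply: cvgN; apply: cvgM; first exact: cvg_cst.
  apply: (continuous_comp (f := fun v => v - l)); last exact: norm_continuous.
  by apply: cvgB; [exact: cvg_id|exact: cvg_cst].
have Ib : (\int[mu]_v (expR (- (nu * `|v - l|)))%:E)%E = (2 / nu)%:E.
  rewrite (integral_shift l cb); last by move=> v; exact: expR_ge0.
  by under eq_integral do rewrite addrK; exact: integral_expRNabs.
have ib : mu.-integrable setT (fun v : R => (expR (- (nu * `|v - l|)))%:E).
  apply/integrableP; split.
    by apply/measurable_EFinP; exact: continuous_measurable_fun.
  under eq_integral do rewrite gee0_abs ?lee_fin ?expR_ge0 //.
  by rewrite Ib ltry.
apply: le_trans (le_normr_Rintegral _ _) _ => //.
apply: (@le_trans _ _ (\int[mu]_v b v)).
  apply: le_Rintegral => //.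
  - exact: (integrable_norm iF).
  - exact: (integrableZl _ (L * eta `^ (2 * nu)) ib).
rewrite RintegralZl // /Rintegral Ib /= /L.
set mx := Num.max _ _; set e2 := _ `^ _.
by rewrite le_eqVlt; apply/orP; left; apply/eqP; ring.
Qed.

End mixture.

(** * Local polynomial reproduction *)

Section polynomial_reproduction.
Context {R : realType}.

Lemma near_identity_solve (I : finType) (A : I -> I -> R) (b : I -> R) :
  (forall i j, `|A i j - (i == j)%:R| <= (2 * #|I|%:R)^-1) ->
  exists2 u : I -> R, (forall j, \sum_i u i * A i j = b j) &
    \sum_i `|u i| <= 2 * \sum_i `|b i|.
Proof.
move=> hA.
have bound (v c : I -> R) : (forall j, \sum_i v i * A i j = c j) ->
    \sum_i `|v i| <= 2 * \sum_i `|c i|.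
  move=> vA; set S := \sum_i `|v i|.
  have S0 : 0 <= S by rewrite sumr_ge0.
  suff : S <= \sum_i `|c i| + S / 2 by lra.
  have vE j : v j = c j - \sum_i v i * (A i j - (i == j)%:R).
    rewrite -vA -sumrB (bigD1 j) //= eqxx big1 => [|i /negPf ->].
      by rewrite addr0 mulrBr mulr1 opprB addrC subrK.
    by rewrite subr0 subrr.
  apply: (@le_trans _ _ (\sum_j (`|c j| + S * (2 * #|I|%:R)^-1))).
    apply: ler_sum => j _; rewrite {1}vE.
    apply: le_trans (ler_normB _ _) _; rewrite lerD2l.
    apply: le_trans (ler_norm_sum _ _ _) _; rewrite mulr_suml.
    by apply: ler_sum => i _; rewrite normrM ler_wpM2l.
  rewrite big_split /= lerD2l sumr_const -[_ *+ _]mulr_natr -mulrA ler_wpM2l //.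
  have [->|n0] := eqVneq (#|{: I}|%:R : R) 0; first by rewrite mulr0 invr_ge0.
  by rewrite invfM -mulrA mulVf // mulr1.
pose M := \matrix_(i < #|I|, j < #|I|) A (enum_val i) (enum_val j).
have sumE (F : I -> R) : \sum_i F i = \sum_(i < #|I|) F (enum_val i).
  by apply: reindex; apply: onW_bij; exact: enum_val_bij.
have MU : M \in unitmx.
  rewrite -row_free_unit; apply: inj_row_free => v vM.
  have : \sum_i `|v ord0 (enum_rank i)| <= 2 * \sum_(i : I) `|(fun=> 0 : R) i|.
    apply: (bound (fun i => v ord0 (enum_rank i))) => j.
    transitivity ((v *m M) ord0 (enum_rank j)); last by rewrite vM mxE.
    rewrite mxE sumE; apply: eq_bigr => i _.
    by rewrite enum_valK [M _ _]mxE enum_rankK.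
  rewrite [X in _ <= _ * X]big1 ?normr0 // mulr0 => h.
  have h0 : \sum_i `|v ord0 (enum_rank i)| == 0 by rewrite eq_le h sumr_ge0.
  apply/rowP => i; rewrite mxE.
  move: h0; rewrite psumr_eq0 // => /allP /(_ (enum_val i) (mem_index_enum _)).
  by rewrite enum_valK normr_eq0 => /eqP.
pose w := (\row_j b (enum_val j)) *m invmx M.
have wE j : \sum_i w ord0 (enum_rank i) * A i j = b j.
  transitivity ((w *m M) ord0 (enum_rank j)).
    rewrite mxE sumE; apply: eq_bigr => i _.
    by rewrite enum_valK [M _ _]mxE enum_rankK.
  by rewrite mulmxKV // mxE enum_rankK.
by exists (fun i => w ord0 (enum_rank i)) => //; exact: bound.
Qed.

Lemma poly_bounded (p : {poly R}) (B : R) :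
  exists2 C : R, 0 <= C & forall x, `|x| <= B -> `|p.[x]| <= C.
Proof.
exists (\sum_(i < size p) `|p`_i| * `|B| ^+ i).
  by apply: sumr_ge0 => i _; rewrite mulr_ge0 // exprn_ge0.
move=> x xB; rewrite horner_coef; apply: le_trans (ler_norm_sum _ _ _) _.
apply: ler_sum => i _; rewrite normrM normrX ler_wpM2l // lerXn2r ?nnegrE //.
exact: le_trans (ler_norm _).
Qed.

Lemma cvg_prod (T : Type) (F : set_system T) (I : Type) (s : seq I)
    (f : I -> T -> R) (l : I -> R) : Filter F ->
  (forall i, f i x @[x --> F] --> l i) ->
  \prod_(i <- s) f i x @[x --> F] --> \prod_(i <- s) l i.
Proof.
move=> FF fl; elim: s => [|i s IH].
  by rewrite big_nil; under eq_fun do rewrite big_nil; exact: cvg_cst.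
by rewrite big_cons; under eq_fun do rewrite big_cons; exact: cvgM.
Qed.

Variables (d n : nat).
Hypothesis n_gt0 : (0 < n)%N.
Local Notation grid := {ffun 'I_d -> 'I_n}.

Definition node (k : nat) : R := k%:R / n%:R.

Lemma node_inj : injective node.
Proof.
move=> i j /(congr1 (fun x => x * n%:R)); rewrite /node !divfK ?pnatr_eq0 -?lt0n //.
by move/eqP; rewrite eqr_nat => /eqP.
Qed.

Definition node_poly (k : 'I_n) : {poly R} := tnth (lagrange n node) k.

(** The tensor product Lagrange basis of the polynomials of degree less than [n] in each
    variable. *)
Definition grid_poly (b : grid) (x : 'rV[R]_d) := \prod_i (node_poly (b i)).[x ord0 i].

Definition grid_node (a : grid) : 'rV[R]_d := \row_i node (a i).

Lemma grid_poly_node a b : grid_poly b (grid_node a) = (a == b)%:R.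
Proof.
rewrite /grid_poly; have [->|/eqP ab] := eqVneq a b.
  by rewrite big1 // => i _; rewrite mxE /node_poly lagrange_sample // ?eqxx //; exact: node_inj.
have [i iab] : exists i, a i != b i.
  apply/existsP; rewrite -negb_forall; apply/negP => /forallP h; apply: ab.
  by apply/ffunP => i; exact/eqP.
rewrite (bigD1 i) //= mxE /node_poly lagrange_sample //; last exact: node_inj.
by rewrite eq_sym (negPf iab) mul0r.
Qed.

Lemma grid_poly_gen (p : 'I_d -> {poly R}) (x : 'rV[R]_d) :
  (forall i, (size (p i) <= n)%N) ->
  \prod_i (p i).[x ord0 i] = \sum_(b : grid) (\prod_i (p i).[node (b i)]) * grid_poly b x.
Proof.
move=> sp.
under eq_bigr => i _.
  rewrite (lagrange_gen n_gt0 node_inj (sp i)) horner_sum; over.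
rewrite bigA_distr_bigA /=; apply: eq_bigr => b _.
rewrite -big_split /=; apply: eq_bigr => i _.
by rewrite hornerM hornerC.
Qed.

(** Continuity of the basis at the grid nodes; there are finitely many pairs, so one radius serves
    them all. The bound is the threshold of [near_identity_solve]. *)
Lemma grid_poly_near : exists2 e : R, 0 < e & forall (a b : grid) (x : 'rV[R]_d),
  (forall i, `|x ord0 i - node (a i)| < e) ->
  `|grid_poly b x - (a == b)%:R| <= (2 * #|{: grid}|%:R)^-1.
Proof.
have cg (b : grid) : continuous (grid_poly b).
  move=> x.
  apply: (@cvg_prod 'rV[R]_d (nbhs (x : 'rV[R]_d)) _ _
    (fun i y => (node_poly (b i)).[y ord0 i]) (fun i => (node_poly (b i)).[x ord0 i])) => i.
  apply: (continuous_comp (f := fun y : 'rV[R]_d => y ord0 i)).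
    exact: coord_continuous.
  exact: continuous_horner.
have N0 : 0 < (2 * #|{: grid}|%:R : R)^-1.
  rewrite invr_gt0 mulr_gt0 // ltr0n; apply/card_gt0P.
  by exists [ffun=> Ordinal n_gt0].
have : \forall e \near 0^'+, forall ab : grid * grid, forall x : 'rV[R]_d,
    (forall i, `|x ord0 i - node (ab.1 i)| < e) ->
    `|grid_poly ab.2 x - (ab.1 == ab.2)%:R| <= (2 * #|{: grid}|%:R)^-1.
  apply: filter_forall => -[a b] /=.
  have := cg b (grid_node a) => /cvgr_dist_le /(_ _ N0) /nbhs_ballP[e /= e0 he].
  near=> e' => x xa; rewrite -grid_poly_node distrC; apply: he.
  split=> // i j; rewrite (ord1 i) mxE /ball/= distrC.
  by apply: lt_le_trans (xa j) _; near: e'; exact: nbhs_right_le.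
move=> h; have [e [he e0]] := filter_ex (filterI h (@nbhs_right_gt R 0)).
by exists e => // a b x xa; exact: (he (a, b)).
Unshelve. all: by end_near. Qed.

Lemma grid_poly_sum_bounded (B : R) : exists2 C : R, 0 <= C &
  forall x : 'rV[R]_d, (forall i, `|x ord0 i| <= B) ->
  \sum_b `|grid_poly b x| <= C.
Proof.
have /choice[C hC] : forall k : 'I_n, exists C : R, 0 <= C /\
    forall x, `|x| <= B -> `|(node_poly k).[x]| <= C.
  by move=> k; have [C C0 h] := poly_bounded (node_poly k) B; exists C.
exists (\sum_(b : grid) \prod_i C (b i)).
  by apply: sumr_ge0 => b _; apply: prodr_ge0 => i _; case: (hC (b i)).
move=> x xB; apply: ler_sum => b _; rewrite normr_prod.
by apply: ler_prod => i _; rewrite normr_ge0 /=; case: (hC (b i)) => _; exact.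
Qed.

(** The values of the Lagrange basis at points near the grid form a matrix near the identity. The
    weights solve the system whose right-hand side is the basis at [w], so they reproduce the basis
    and hence its span. The point [w] may lie far from the grid: [B] affects [M], not the tolerance
    [e]. *)
Lemma local_polynomial_reproduction (B : R) : exists e M : R, [/\ 0 < e, 0 <= M &
  forall (xi : grid -> 'rV[R]_d) (w : 'rV[R]_d),
  (forall a i, `|xi a ord0 i - node (a i)| < e) -> (forall i, `|w ord0 i| <= B) ->
  exists2 u : grid -> R, \sum_a `|u a| <= M &
    forall p : 'I_d -> {poly R}, (forall i, (size (p i) <= n)%N) ->
    \sum_a u a * \prod_i (p i).[xi a ord0 i] = \prod_i (p i).[w ord0 i]].
Proof.
have [e e0 he] := grid_poly_near; have [C C0 hC] := grid_poly_sum_bounded B.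
exists e, (2 * C); split=> //; first by rewrite mulr_ge0.
move=> xi w hxi hw.
have [u uE uC] := @near_identity_solve _ (fun a b => grid_poly b (xi a))
  (fun b => grid_poly b w) (fun a b => he a b _ (hxi a)).
exists u; first by rewrite (le_trans uC) // ler_wpM2l // hC.
move=> p sp; rewrite (grid_poly_gen w sp).
under eq_bigr => a _ do rewrite (grid_poly_gen (xi a) sp) mulr_sumr.
rewrite exchange_big /=; apply: eq_bigr => b _; rewrite -uE mulr_sumr.
by apply: eq_bigr => a _; ring.
Qed.

End polynomial_reproduction.

(** * Positive semidefinite forms on function spaces *)

Section forms.
Context {R : realType} (T : Type).
Implicit Types (g h v : T -> R).

(* Both [rkhs_dot], on its carrier only, and [matern_cov] are instances. *)
Record form_on (S : set (T -> R)) (B : (T -> R) -> (T -> R) -> R) := FormOn {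
  form_zero : S (fun=> 0) ;
  form_lin : forall (a : R) g h, S g -> S h -> S (fun x => a * g x + h x) ;
  form_C : forall g h, S g -> S h -> B g h = B h g ;
  form_dot_lin : forall (a : R) g h k, S g -> S h -> S k ->
    B (fun x => a * g x + h x) k = a * B g k + B h k }.

Variables (S : set (T -> R)) (B : (T -> R) -> (T -> R) -> R).
Hypothesis fB : form_on S B.

Lemma form_dot0l k : S k -> B (fun=> 0) k = 0.
Proof.
move=> Sk; have S0 := form_zero fB.
have := form_dot_lin fB 1 S0 S0 Sk.
have -> : (fun x : T => 1 * 0 + 0) = (fun=> 0) :> (T -> R).
  by apply/funext => x; ring.
lra.
Qed.

Lemma form_sum (I : Type) (s : seq I) (a : I -> R) (v : I -> T -> R) :
  (forall i, S (v i)) -> S (fun x => \sum_(i <- s) a i * v i x).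
Proof.
move=> Sv; elim: s => [|i s IH].
  by under eq_fun do rewrite big_nil; exact: form_zero fB.
by under eq_fun do rewrite big_cons; exact: form_lin fB _ _ _ _ _.
Qed.

Lemma form_dot_suml (I : Type) (s : seq I) (a : I -> R) (v : I -> T -> R) k :
  (forall i, S (v i)) -> S k ->
  B (fun x => \sum_(i <- s) a i * v i x) k = \sum_(i <- s) a i * B (v i) k.
Proof.
move=> Sv Sk; elim: s => [|i s IH].
  by rewrite big_nil; under eq_fun do rewrite big_nil; exact: form_dot0l.
rewrite big_cons; under eq_fun do rewrite big_cons.
by rewrite (form_dot_lin fB) ?IH //; exact: form_sum.
Qed.

Lemma form_dot_sum (I : Type) (s : seq I) (a : I -> R) (v : I -> T -> R) :
  (forall i, S (v i)) ->
  B (fun x => \sum_(i <- s) a i * v i x) (fun x => \sum_(i <- s) a i * v i x) =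
  \sum_(i <- s) \sum_(j <- s) a i * a j * B (v i) (v j).
Proof.
move=> Sv; rewrite form_dot_suml //; last exact: form_sum.
apply: eq_bigr => i _.
rewrite (form_C fB) //; last exact: form_sum.
rewrite form_dot_suml // mulr_sumr; apply: eq_bigr => j _.
by rewrite (form_C fB) //; ring.
Qed.

Lemma form_sub g h : S g -> S h -> S (fun x => g x - h x).
Proof.
move=> Sg Sh; have -> : (fun x => g x - h x) = (fun x => - 1 * h x + g x).
  by apply/funext => x; ring.
exact: form_lin fB _ _ _ _ _.
Qed.

Lemma form_dot_subl g h k : S g -> S h -> S k ->
  B (fun x => g x - h x) k = B g k - B h k.
Proof.
move=> Sg Sh Sk; have -> : (fun x => g x - h x) = (fun x => - 1 * h x + g x).
  by apply/funext => x; ring.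
by rewrite (form_dot_lin fB) //; ring.
Qed.

Hypothesis B0 : forall g, S g -> 0 <= B g g.

Lemma form_cauchy_schwarz g h : S g -> S h -> B g h ^+ 2 <= B g g * B h h.
Proof.
move=> Sg Sh.
have q (t : R) : 0 <= t ^+ 2 * B g g + 2 * t * B g h + B h h.
  have Sk := form_lin fB t Sg Sh.
  have := B0 Sk; rewrite (form_dot_lin fB) // (form_C fB Sg Sk) (form_C fB Sh Sk).
  rewrite !(form_dot_lin fB) // (form_C fB Sh Sg).
  by congr (_ <= _); ring.
(* If [B g g = 0], the quadratic in [t] is affine and nonnegative, so its slope vanishes: otherwise
   the [t] chosen below would give it the value -1. If [B g g > 0], it is evaluated at its
   minimum. *)
have := B0 Sg; rewrite le_eqVlt => /predU1P[g0|g0].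
  rewrite -g0 mul0r; move: q; rewrite -g0 => q.
  have [->|b] := eqVneq (B g h) 0; first by rewrite expr0n.
  have := q (- (B h h + 1) / (2 * B g h)).
  rewrite mulr0 add0r; have -> : 2 * (- (B h h + 1) / (2 * B g h)) * B g h = - (B h h + 1) by field.
  lra.
have := q (- B g h / B g g).
have -> : (- B g h / B g g) ^+ 2 * B g g + 2 * (- B g h / B g g) * B g h + B h h =
  (B g g * B h h - B g h ^+ 2) / B g g by field; exact: lt0r_neq0.
by rewrite pmulr_lge0 ?invr_gt0 // subr_ge0.
Qed.

(* Gram-Schmidt, so that the [v i] need not be linearly independent. *)
Lemma form_projection (n : nat) (v : 'I_n -> T -> R) : (forall i, S (v i)) ->
  forall g, S g -> exists a : 'I_n -> R,
    forall k, B (fun x => g x - \sum_j a j * v j x) (v k) = 0.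
Proof.
elim: n v => [|n IH] v Sv g Sg; first by exists (fun=> 0) => -[].
pose v' i := v (lift ord_max i).
have Sv' i : S (v' i) by exact: Sv.
have [b hb] := IH v' Sv' _ (Sv ord_max); have [a ha] := IH v' Sv' _ Sg.
pose w x := v ord_max x - \sum_j b j * v' j x.
pose e x := g x - \sum_j a j * v' j x.
have Sw : S w by apply: form_sub => //; exact: form_sum.
have Se : S e by apply: form_sub => //; exact: form_sum.
have wv' k : B (v' k) w = 0 by rewrite (form_C fB).
have [t ht] : exists t, B (fun x => e x - t * w x) w = 0.
  have Sz t : S (fun x => t * w x).
    have -> : (fun x => t * w x) = (fun x => t * w x + 0) by apply/funext => x; ring.
    exact: form_lin fB _ _ _ Sw (form_zero fB).
  have zE t : B (fun x => t * w x) w = t * B w w.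
    have -> : (fun x => t * w x) = (fun x => t * w x + 0) by apply/funext => x; ring.
    by rewrite (form_dot_lin fB) ?form_dot0l ?addr0 //; exact: (form_zero fB).
  (* If the new direction [w] has norm zero, Cauchy-Schwarz already gives [B e w = 0], and [t = 0]
     serves. *)
  have [w0|w0] := eqVneq (B w w) 0.
    exists 0; rewrite form_dot_subl // zE w0 mul0r subr0.
    have := form_cauchy_schwarz Se Sw; rewrite w0 mulr0 => h.
    by apply/eqP; rewrite -sqrf_eq0 eq_le h sqr_ge0.
  by exists (B e w / B w w); rewrite form_dot_subl // zE divfK // subrr.
exists (fun j => if unlift ord_max j is Some i then a i - t * b i else t).
have -> : (fun x => g x - \sum_j (if unlift ord_max j is Some i then a i - t * b i else t) * v j x)
    = (fun x => e x - t * w x).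
  apply/funext => x; rewrite big_ord_recr /= unlift_none.
  under eq_bigr => i _.
    rewrite (_ : widen_ord _ i = lift ord_max i); last first.
      by apply: val_inj; rewrite /= /bump leqNgt ltn_ord.
    rewrite liftK mulrBl -mulrA; over.
  rewrite /e /w sumrB -mulr_sumr /v'; ring.
have Sz : S (fun x => t * w x).
  have -> : (fun x => t * w x) = (fun x => t * w x + 0) by apply/funext => x; ring.
  exact: form_lin fB _ _ _ Sw (form_zero fB).
have ezv' i : B (fun x => e x - t * w x) (v' i) = 0.
  rewrite form_dot_subl // ha.
  have -> : (fun x => t * w x) = (fun x => t * w x + 0) by apply/funext => x; ring.
  rewrite (form_dot_lin fB) ?form_dot0l ?hb //; first by ring.
  exact: form_zero fB.
move=> k; case: (unliftP ord_max k) => [i ->|->]; first exact: ezv'.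
have -> : v ord_max = (fun x => 1 * w x + \sum_j b j * v' j x).
  by apply/funext => x; rewrite /w; ring.
have Sez : S (fun x => e x - t * w x) by exact: form_sub.
rewrite (form_C fB) //; last by apply: (form_lin fB) => //; exact: form_sum.
rewrite (form_dot_lin fB) //; last exact: form_sum.
rewrite (form_C fB Sw Sez) ht form_dot_suml // big1 ?mulr0 ?addr0 // => j _.
by rewrite (form_C fB) // ezv' mulr0.
Qed.

(** Pythagoras for the orthogonal decomposition of [g] into [g - s] and [s]. *)
Lemma form_projection_le g s : S g -> S s -> B (fun x => g x - s x) s = 0 ->
  B (fun x => g x - s x) (fun x => g x - s x) <= B g g.
Proof.
move=> Sg Ss o; have Se := form_sub Sg Ss.
have -> : B g g = B (fun x => g x - s x) (fun x => g x - s x) + B s s.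
  have {1 2}-> : g = (fun x => 1 * (g x - s x) + s x) by apply/funext => x; ring.
  have Sk : S (fun x => 1 * (g x - s x) + s x) by exact: form_lin fB _ _ _ _ _.
  rewrite (form_dot_lin fB) // (form_C fB Se Sk) (form_C fB Ss Sk).
  by rewrite !(form_dot_lin fB) // (form_C fB Ss Se) o; ring.
by rewrite lerDl B0.
Qed.

End forms.

(** * Compact convex sets and designs *)

Section euclidean.
Context {R : realType} (d : nat).
Implicit Types (x y : 'rV[R]_d) (Omega : set 'rV[R]_d).

Lemma norm2_ge0 x : 0 <= norm2 x.
Proof. exact: sqrtr_ge0. Qed.

Lemma coord_le_norm2 x i : `|x ord0 i| <= norm2 x.
Proof.
rewrite -sqrtr_sqr ler_wsqrtr // (bigD1 i) //= lerDl sumr_ge0 // => j _.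
exact: sqr_ge0.
Qed.

Lemma norm2_le x (b : R) : (forall i, `|x ord0 i| <= b) -> norm2 x <= d%:R * b.
Proof.
move=> xb; have [d0|d0] := posnP d.
  rewrite /norm2 big1 ?sqrtr0 => [|i _]; first by rewrite d0 mul0r.
  by have := ltn_ord i; rewrite {2}d0.
have b0 : 0 <= b by apply: le_trans (xb (Ordinal d0)).
have db0 : 0 <= d%:R * b by rewrite mulr_ge0.
rewrite -(ger0_norm db0) -sqrtr_sqr ler_wsqrtr //.
apply: (@le_trans _ _ (\sum_(i < d) b ^+ 2)).
  apply: ler_sum => i _; rewrite -[leLHS]real_normK ?num_real //.
  by rewrite lerXn2r ?nnegrE.
rewrite sumr_const card_ord -[leLHS]mulr_natl exprMn ler_wpM2r ?sqr_ge0 //.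
by rewrite -natrX ler_nat -{1}(expn1 d) leq_pexp2l.
Qed.

Lemma compact_coord_bounded Omega : compact Omega ->
  exists2 D : R, 0 < D & forall x i, Omega x -> `|x ord0 i| <= D.
Proof.
move=> cO.
have /choice[D hD] : forall i : 'I_d, exists D : R, forall x, Omega x -> `|x ord0 i| <= D.
  move=> i; have : compact [set x ord0 i | x in Omega].
    apply: continuous_compact => //; apply: continuous_subspaceT.
    exact: coord_continuous.
  move=> /compact_bounded [M [Mr hM]]; exists (`|M| + 1) => x Ox.
  by apply: hM; [rewrite (le_lt_trans (ler_norm _)) ?ltrDl|exists x].
exists (1 + \sum_i `|D i|); first by rewrite ltr_pwDl ?sumr_ge0.
move=> x i Ox; apply: le_trans (hD i x Ox) _.
rewrite (bigD1 i) //=; have := ler_norm (D i).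
have : 0 <= \sum_(j | j != i) `|D j| by rewrite sumr_ge0.
lra.
Qed.

(** The sigma-algebra is generated by the coordinates, so an open set is exhibited as the union of
    the countably many rational boxes inside it. *)
Lemma open_measurable_rV (U : set 'rV[R]_d) : open U -> measurable U.
Proof.
move=> oU.
pose box (p : {ffun 'I_d -> rat} * nat) : set 'rV[R]_d :=
  [set x | forall i, ratr (p.1 i) - p.2.+1%:R^-1 < x ord0 i < ratr (p.1 i) + p.2.+1%:R^-1].
have mbox p : measurable (box p).
  rewrite (_ : box p = \bigcap_(i in [set: 'I_d]) ((fun x : 'rV[R]_d => x ord0 i : measurableTypeR R) @^-1`
     `]ratr (p.1 i) - p.2.+1%:R^-1, ratr (p.1 i) + p.2.+1%:R^-1[)).
    apply: fin_bigcap_measurable => // i _; rewrite -[X in measurable X]setTI.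
    by apply: measurable_coor => //; exact: measurable_itv.
  apply/seteqP; split => x /= Hx i; first by move=> _ /=; rewrite in_itv/=; exact: Hx.
  by have := Hx i I; rewrite /= in_itv.
pose F p := if pselect (box p `<=` U) then box p else set0.
have mF p : measurable (F p).
  by rewrite /F; case: pselect => h; [exact: mbox|exact: measurable0].
suff -> : U = \bigcup_p F p by apply: countable_bigcupT_measurable => //; exact: countableP.
apply/seteqP; split => [x Ux|x [p _]]; last by rewrite /F; case: pselect => // pU /pU.
have := open_nbhs_nbhs (conj oU Ux) => /nbhs_ballP[e /= e0 he].
have e20 : 0 < e / 2 by rewrite divr_gt0.
(* A box of half-width at most [e / 2] that contains [x] stays within distance [e] of [x]. *)
have [k kx] := exists_invS_le e20.
have k0 : 0 < k.+1%:R^-1 :> R by rewrite invr_gt0.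
have /choice[q hq] : forall i : 'I_d, exists q : rat,
    ratr q \in `]x ord0 i - k.+1%:R^-1, x ord0 i + k.+1%:R^-1[.
  by move=> i; apply: rat_in_itvoo; rewrite ltrD2l (@lt_trans _ _ 0) // oppr_lt0.
exists ([ffun i => q i], k) => //.
have xb : box ([ffun i => q i], k) x.
  move=> i /=; rewrite ffunE; have := hq i; rewrite in_itv/=.
  by set r := _^-1; lra.
rewrite /F; case: pselect => // -[]; apply: subset_trans he => y yb.
split=> // i j; rewrite (ord1 i) /ball/= ltr_distlC.
have /= := yb j; have /= := xb j; rewrite ffunE; move: kx.
by set r := k.+1%:R^-1; lra.
Qed.

Lemma compact_measurable_rV Omega : compact Omega -> measurable Omega.
Proof.
move=> cO; rewrite -(setCK Omega); apply: measurableC; apply: open_measurable_rV.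
by apply: closed_openC; apply: compact_closed => //; exact: norm_hausdorff.
Qed.

Lemma convex_setP Omega : convex_set Omega -> forall x y (t : R),
  Omega x -> Omega y -> 0 <= t -> t <= 1 -> Omega (t *: x + (1 - t) *: y).
Proof.
move=> cO x y t Ox Oy t0 t1.
have := cO x y (Itv01 t0 t1); rewrite !inE => /(_ Ox Oy).
by [].
Qed.

(** A convex combination in which [p0] carries the remaining weight. The induction splits off one
    point and rescales the other weights by [1 - u i], which is why [u i = 1] is treated apart. *)
Lemma convex_set_sum Omega (I : eqType) (p0 : 'rV[R]_d) (p : I -> 'rV[R]_d) :
  convex_set Omega -> Omega p0 -> (forall i, Omega (p i)) ->
  forall (s : seq I) (u : I -> R), (forall i, 0 <= u i) -> \sum_(i <- s) u i <= 1 ->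
  Omega (p0 + \sum_(i <- s) u i *: (p i - p0)).
Proof.
move=> cO O0 Op; elim=> [|i s IH] u u0 u1; first by rewrite big_nil addr0.
have S0 : 0 <= \sum_(j <- s) u j by rewrite sumr_ge0.
move: u1; rewrite !big_cons => u1.
have [ui1|ui1] := eqVneq (u i) 1.
  have Sz : \sum_(j <- s) u j == 0 by rewrite eq_le S0 andbT; lra.
  rewrite big_seq big1 ?addr0; first by rewrite ui1 scale1r addrC subrK.
  move=> j js; move: Sz; rewrite psumr_eq0 // => /allP /(_ _ js) /eqP ->.
  by rewrite scale0r.
have ui0 : 0 < 1 - u i by rewrite subr_gt0 lt_neqAle ui1 /=; lra.
have := convex_setP cO (Op i) (IH (fun j => u j / (1 - u i)) _ _) (u0 i) _.
rewrite -mulr_suml ler_pdivrMr // mul1r => /(_ (fun j => divr_ge0 (u0 j) (ltW ui0))).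
have h1 : \sum_(j <- s) u j <= 1 - u i by lra.
have h2 : u i <= 1 by lra.
move=> /(_ h1 h2); congr Omega.
rewrite scalerDr scaler_sumr.
rewrite (eq_bigr (fun j => u j *: (p j - p0))); last first.
  by move=> j _; rewrite scalerA mulrC divfK // lt0r_neq0.
by set z := \sum_(_ <- _) _; apply/rowP => j; rewrite !mxE; ring.
Qed.

End euclidean.

(** * A cube inside a convex set of positive measure *)

Section interior.
Context {R : realType}.

(** The induction follows the construction of the measure as a product. If a later coefficient is
    nonzero, all slices are hyperplanes of lower dimension; otherwise the set is a point times the
    whole space. *)
Lemma hyperplane_null n (a : 'rV[R]_n) (b : R) : a != 0 ->
  lebesgue_rV n [set x : 'rV[R]_n | \sum_i a ord0 i * x ord0 i = b] = 0%E.
Proof.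
elim: n a b => [|n IH] a b a0.
  by case/negP: a0; apply/eqP/rowP => -[].
rewrite /= /lebesgue_rV_step /pushforward.
pose a' : 'rV[R]_n := \row_i a ord0 (lift ord0 i).
have -> : @rV_cons R n @^-1` [set x | \sum_i a ord0 i * x ord0 i = b] =
    [set p : measurableTypeR R * 'rV[R]_n | a ord0 ord0 * p.1 + \sum_i a' ord0 i * p.2 ord0 i = b].
  have sumE p : \sum_i a ord0 i * rV_cons p ord0 i =
      a ord0 ord0 * p.1 + \sum_i a' ord0 i * p.2 ord0 i.
    rewrite big_ord_recl rV_cons0; congr (_ + _).
    by apply: eq_bigr => i _; rewrite rV_consS mxE.
  by apply/seteqP; split => p /=; rewrite sumE.
have [a'0|a'0] := eqVneq a' 0; last first.
  apply: integral0_eq => x _ /=.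
  rewrite -[RHS](IH a' (b - a ord0 ord0 * x) a'0); congr (lebesgue_rV n _).
  apply/seteqP; split => y; rewrite /xsection /= inE /= => h; lra.
have a00 : a ord0 ord0 != 0.
  apply: contra a0 => /eqP a00; apply/eqP/rowP => i; rewrite mxE.
  case: (unliftP ord0 i) => [k ->|->//].
  by have /rowP/(_ k) := a'0; rewrite !mxE.
have -> : [set p : measurableTypeR R * 'rV[R]_n |
     a ord0 ord0 * p.1 + \sum_i a' ord0 i * p.2 ord0 i = b] =
   [set b / a ord0 ord0] `*` setT.
  apply/seteqP; split => p /=; rewrite a'0 big1 ?addr0 => [|i _]; rewrite ?mxE ?mul0r //.
    by move=> <-; split => //; rewrite mulrAC divff // mul1r.
  by move=> [-> _]; rewrite mulrC divfK.
apply: etrans (product_measure1E _ _ _ _) _ => //.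
by rewrite [X in (X * _)%E](lebesgue_measure_set1 _) mul0e.
Qed.

Variables (d : nat) (Omega : set 'rV[R]_d).
Hypothesis cO : convex_set Omega.
Hypothesis mO : measurable Omega.
Hypothesis O0 : (0 < lebesgue_rV d Omega)%E.

Lemma not_sub_hyperplane (a : 'rV[R]_d) (b : R) : a != 0 ->
  exists2 x, Omega x & \sum_i a ord0 i * x ord0 i != b.
Proof.
move=> a0; apply: contrapT => h.
suff : (lebesgue_rV d Omega <= 0)%E by rewrite leNgt O0.
rewrite -(hyperplane_null b a0); apply: le_measure; rewrite ?inE //.
  have mf : measurable_fun setT (fun x : 'rV[R]_d => \sum_i a ord0 i * x ord0 i).
    by apply: measurable_sum => i; apply: measurable_funM => //; exact: measurable_coor.
  by have := mf measurableT _ (measurable_set1 b); rewrite setTI.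
move=> x Ox /=; apply: contrapT => /eqP ne; apply: h; by exists x.
Qed.

(** While fewer than [d] independent directions are found, some nonzero [a] is orthogonal to all of
    them. [Omega] has positive measure, so it leaves the hyperplane through [p0] with normal [a],
    and such a point supplies a new direction. *)
Lemma convex_spanning : exists2 p0, Omega p0 &
  exists2 M : 'M[R]_d, M \in unitmx & forall i, Omega (p0 + row i M).
Proof.
have [p0 Op0] : Omega !=set0.
  by apply/set0P/eqP => e; move: O0; rewrite e measure0 ltxx.
exists p0 => //.
have : forall k, (k <= d)%N -> exists2 M : 'M[R]_(k, d), row_free M &
    forall i, Omega (p0 + row i M).
  elim=> [|k IH] kd.
    by exists 0; [rewrite /row_free mxrank0|case].
  have [M fM OM] := IH (ltnW kd).
  have [a /andP[a0 Ma]] : exists a : 'rV[R]_d, (a != 0) && (M *m a^T == 0).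
    have : kermx M^T != 0.
      rewrite -mxrank_eq0 mxrank_ker mxrank_tr; move: fM; rewrite /row_free => /eqP ->.
      by rewrite subn_eq0 -ltnNge.
    case/rowV0Pn => a /sub_kermxP aM a0; exists a; rewrite a0 /=.
    by rewrite -[M]trmxK -trmx_mul aM trmx0.
  have [x Ox xa] := not_sub_hyperplane (\sum_i a ord0 i * p0 ord0 i) a0.
  exists (col_mx (x - p0) M : 'M[R]_(1 + k, d)); last first.
    move=> i; case: (@split_ordP 1 k i) => j ->.
      by rewrite (@rowKu _ 1) ord1 row_id addrC subrK.
    by rewrite (@rowKd _ 1).
  rewrite /row_free [X in X == _](_ : _ = \rank (x - p0 + M)%MS); last by rewrite addsmxE.
  have xM : ~~ (x - p0 <= M)%MS.
    apply/negP => /submxP[u xE]; move/eqP: xa; apply.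
    have : (x - p0) *m a^T = 0 by rewrite xE -mulmxA (eqP Ma) mulmx0.
    move/matrixP/(_ ord0 ord0); rewrite !mxE.
    under eq_bigr do rewrite !mxE mulrBl.
    rewrite sumrB => /eqP; rewrite subr_eq0 => /eqP.
    by under eq_bigr do rewrite mulrC; under [RHS]eq_bigr do rewrite mulrC.
  rewrite eqn_leq; apply/andP; split.
    by rewrite addsmxE rank_leq_row.
  rewrite -[k in (k < _)%N](eqP fM).
  rewrite (ltn_leqif (mxrank_leqif_sup (addsmxSr (x - p0) M))).
  by rewrite addsmx_sub negb_and xM.
move/(_ d (leqnn d)) => [M fM OM]; exists M => //.
by rewrite -row_free_unit.
Qed.

(* [Omega] contains the simplex with vertices [p0] and [p0 + row i M], whose
   barycentre is the centre of the cube. *)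
Lemma convex_cube : exists c : 'rV[R]_d, exists2 rho : R, 0 < rho &
  forall x : 'rV[R]_d, (forall i, `|x ord0 i - c ord0 i| <= rho) -> Omega x.
Proof.
have [p0 Op0 [M uM OM]] := convex_spanning.
pose N := invmx M.
have [D DE] : exists D : R, D = d.+1%:R by exists d.+1%:R.
have D0 : 0 < D by rewrite DE ltr0n.
pose K := 1 + \sum_i \sum_j `|N i j|.
have K0 : 0 < K by rewrite ltr_pwDl // sumr_ge0 // => i _; rewrite sumr_ge0.
pose b : 'rV[R]_d := const_mx D^-1.
pose c := p0 + b *m M.
(* [K] bounds the entries of [N], so in this cube the coordinates [u] differ from [D^-1] by at most
   [D^-1 * D^-1]. As [d%:R = D - 1], they stay nonnegative and their sum is at most $1-D^{-2}$. *)
exists c; exists (D ^+ 2 * K)^-1; first by rewrite invr_gt0 mulr_gt0 // exprn_gt0.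
move=> x xc.
pose u := (x - p0) *m N.
have xE : x = p0 + u *m M by rewrite mulmxKV // addrC subrK.
have uE i : u ord0 i = D^-1 + ((x - c) *m N) ord0 i.
  have -> : x - c = (x - p0) - b *m M by rewrite /c opprD addrA.
  by rewrite mulmxBl mulmxK // [X in _ = _ + X]mxE [X in _ = _ + (_ + X)]mxE !mxE; ring.
have small i : `|((x - c) *m N) ord0 i| <= (D ^+ 2)^-1.
  rewrite mxE; apply: le_trans (ler_norm_sum _ _ _) _.
  apply: (@le_trans _ _ (\sum_j (D ^+ 2 * K)^-1 * `|N j i|)).
    apply: ler_sum => j _; rewrite normrM ler_wpM2r //; apply: le_trans (xc j).
    by rewrite [(x - c) _ _]mxE [X in _ + X]mxE.
  rewrite -mulr_sumr invfM -mulrA ler_piMr ?invr_ge0 ?exprn_ge0 ?(ltW D0) //.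
  rewrite ler_pdivrMl // mulr1 /K.
  apply: (@le_trans _ _ (\sum_i \sum_j `|N i j|)); last by rewrite lerDr.
  by apply: ler_sum => j _; rewrite (bigD1 i) //= lerDl sumr_ge0.
have Dd : D^-1 <= 1 by rewrite invf_le1 // DE ler1n.
have DV : (D ^+ 2)^-1 = D^-1 * D^-1 by rewrite expr2 invfM.
have u0 i : 0 <= u ord0 i.
  have := small i; rewrite ler_norml uE DV => /andP[h _].
  have : D^-1 * D^-1 <= D^-1 by rewrite ler_piMl // invr_ge0 ltW.
  lra.
have u1 : \sum_i u ord0 i <= 1.
  apply: (@le_trans _ _ (\sum_(i < d) (D^-1 + D^-1 * D^-1))).
    apply: ler_sum => i _; rewrite uE lerD2l -DV.
    exact: le_trans (ler_norm _) (small i).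
  rewrite sumr_const card_ord -mulr_natl.
  have -> : d%:R = D - 1 :> R by rewrite DE -natr1 addrK.
  rewrite mulrBl mulrDr mulrA divff ?lt0r_neq0 // mul1r.
  have : 0 <= D^-1 * D^-1 by rewrite mulr_ge0 // invr_ge0 ltW.
  lra.
have := @convex_set_sum _ _ _ _ p0 (fun i => p0 + row i M) cO Op0 OM (index_enum 'I_d) _ u0 u1.
congr Omega; rewrite [RHS]xE mulmx_sum_row; congr (_ + _).
by apply: eq_bigr => i _; rewrite addrC addrA addNr add0r.
Qed.

End interior.

(** * Fill distance and separation distance *)

Section designs.
Context {R : realType} (d : nat) (Omega : set 'rV[R]_d) (D : R).
Hypothesis D0 : 0 < D.
Hypothesis OD : forall x i, Omega x -> `|x ord0 i| <= D.

Lemma set_valP_in (x : Omega) : Omega (\val x).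
Proof. by case: x => x /= /set_mem. Qed.

Lemma norm2_sub_le (x y : 'rV[R]_d) : Omega x -> Omega y ->
  norm2 (x - y) <= d%:R * (2 * D).
Proof.
move=> Ox Oy; apply: norm2_le => i; rewrite !mxE.
apply: le_trans (ler_normB _ _) _.
by have := OD i Ox; have := OD i Oy; lra.
Qed.

(** The infimum over the indices is a minimum, and boundedness of [Omega] makes the supremum a
    genuine upper bound. *)
Lemma fill_distance_attained n (X : 'I_n -> Omega) (x : 'rV[R]_d) :
  (0 < n)%N -> Omega x -> exists j, norm2 (x - \val (X j)) <= fill_distance X.
Proof.
case: n X => // n X _ Ox.
pose E (y : 'rV[R]_d) := [set norm2 (y - \val (X j)) | j in [set: 'I_n.+1]].
have E0 y : has_lbound (E y) by exists 0 => _ [j _ <-]; exact: norm2_ge0.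
pose j0 := [arg min_(j < ord0) norm2 (x - \val (X j))]%O.
exists j0; apply: (@le_trans _ _ (inf (E x))).
  apply: lb_le_inf; first by exists (norm2 (x - \val (X ord0))); exists ord0.
  move=> _ [j _ <-]; rewrite /j0; case: arg_minP => // i _; exact.
apply: ub_le_sup; last by exists x.
exists (d%:R * (2 * D)) => _ [y Oy <-].
apply: (@le_trans _ _ (norm2 (y - \val (X ord0)))).
  by apply: ge_inf; [exact: E0|exists ord0].
by apply: norm2_sub_le => //; exact: set_valP_in.
Qed.

Lemma separation_distance_le n (X : 'I_n -> Omega) j k : j != k ->
  separation_distance X <= norm2 (\val (X j) - \val (X k)) / 2.
Proof.
move=> jk; apply: ge_inf; last by exists (j, k).
by exists 0 => _ [[i l] _ <-]; rewrite divr_ge0 // norm2_ge0.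
Qed.

(* With [N ^ d < n], two of the [n] points lie in the same cell when the bounding
   cube is cut into [N ^ d] cells. *)
Lemma separation_distance_bound n (X : 'I_n -> Omega) : (0 < d)%N -> (2 <= n)%N ->
  separation_distance X <= d%:R * (2 * D + 1) * n%:R `^ (- d%:R^-1).
Proof.
move=> d0 n2.
have [N N0 /andP[Nn nN]] : exists2 N, (0 < N)%N & (N ^ d < n <= N.+1 ^ d)%N.
  have ex1 : exists N, (N ^ d < n)%N by exists 1%N; rewrite exp1n.
  have ub N : (N ^ d < n)%N -> (N <= n)%N.
    move=> h; apply: ltnW; apply: leq_ltn_trans h.
    by case: N => // N; rewrite -{1}(expn1 N.+1) leq_pexp2l.
  case: (ex_maxnP ex1 ub) => N Nn maxN; exists N.
    by apply: maxN; rewrite exp1n.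
  by rewrite Nn /= leqNgt; apply/negP => /maxN; rewrite ltnn.
have L0 : 0 < 2 * D + 1 by rewrite addr_gt0 // mulr_gt0.
(* Coordinates rescaled to [[0, 1[]. Dividing by [2 * D + 1] instead of [2 * D] keeps them strictly
   below 1, so the cell index is less than [N]. *)
pose v j i := (\val (X j) ord0 i + D) / (2 * D + 1).
have v01 j i : 0 <= v j i < 1.
  have := OD i (set_valP_in (X j)); rewrite ler_norml => /andP[h1 h2].
  by rewrite /v divr_ge0 ?ltr_pdivrMr //=; lra.
have N0R : 0 < N%:R :> R by rewrite ltr0n.
have vN0 j i : 0 <= v j i * N%:R by case/andP: (v01 j i) => h _; rewrite mulr_ge0.
have cell_lt j i : (Num.truncn (v j i * N%:R) < N)%N.
  have /andP[h _] := truncn_itv (vN0 j i).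
  rewrite -(ltr_nat R); apply: le_lt_trans h _.
  by case/andP: (v01 j i) => _ h; rewrite gtr_pMl.
pose cell j : {ffun 'I_d -> 'I_N} := [ffun i => Ordinal (cell_lt j i)].
have [j [k jk cjk]] : exists j, exists2 k, j != k & cell j = cell k.
  apply: contrapT => h.
  have /leq_card : injective cell.
    move=> j k cjk; apply/eqP; apply: contrapT => /negP jk; apply: h.
    by exists j, k.
  by rewrite card_ffun !card_ord leqNgt Nn.
apply: le_trans (separation_distance_le X jk) _.
have close i : `|(\val (X j) - \val (X k)) ord0 i| <= (2 * D + 1) / N%:R.
  have := congr1 (fun c : {ffun 'I_d -> 'I_N} => val (c i)) cjk; rewrite !ffunE /= => tjk.
  have /andP[a1 a2] := truncn_itv (vN0 j i); have /andP[b1 b2] := truncn_itv (vN0 k i).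
  rewrite tjk in a1 a2.
  have E l : \val (X l) ord0 i = v l i * (2 * D + 1) - D by rewrite /v divfK ?lt0r_neq0 // addrK.
  rewrite mxE [X in _ + X]mxE !E.
  have -> : v j i * (2 * D + 1) - D - (v k i * (2 * D + 1) - D) =
    (v j i * N%:R - v k i * N%:R) * ((2 * D + 1) / N%:R) by field; exact: lt0r_neq0.
  rewrite normrM [X in _ * X]ger0_norm ?divr_ge0 ?(ltW L0) //.
  rewrite ler_piMl ?divr_ge0 ?(ltW L0) // ler_norml.
  move: a1 a2 b1 b2; rewrite -!natr1; set t := (Num.truncn _)%:R; lra.
have h1 := norm2_le close.
(* From [n <= N.+1 ^ d] and [N.+1 <= 2 * N]; the factor 2 cancels against the halving in the
   separation distance. *)
have nroot : (n%:R : R) `^ (d%:R^-1) <= 2 * N%:R.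
  apply: (@le_trans _ _ (N.+1%:R : R)); last first.
    by rewrite -natrM ler_nat mul2n -addnn -addn1 leq_add2l.
  have -> : N.+1%:R = (N.+1 ^ d)%:R `^ (d%:R^-1) :> R.
    by rewrite natrX -powR_mulrn // -powRrM mulfV ?powRr1 // pnatr_eq0 -lt0n.
  by apply: ge0_ler_powR; rewrite ?nnegrE ?invr_ge0 ?ler_nat.
have np : 0 < (n%:R : R) `^ (d%:R^-1) by rewrite powR_gt0 // ltr0n (leq_trans _ n2).
rewrite powRN; set p := _ `^ _ in nroot np *.
have pN : N%:R^-1 <= 2 / p by rewrite ler_pdivlMr // mulrC ler_pdivrMr.
rewrite ler_pdivrMr //; apply: le_trans h1 _.
have -> : d%:R * (2 * D + 1) / p * 2 = d%:R * ((2 * D + 1) * (2 / p)) by ring.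
by rewrite ler_wpM2l // ler_wpM2l // ltW.
Qed.

Lemma fill_distance_ge0 n (X : 'I_n -> Omega) : (0 < n)%N -> 0 <= fill_distance X.
Proof.
move=> n0; have [j] := fill_distance_attained X n0 (set_valP_in (X (Ordinal n0))).
exact/le_trans/norm2_ge0.
Qed.

Lemma quasi_uniform_fill_distance (C' : R) : (0 < d)%N -> exists2 C : R, 0 < C &
  forall n (X : 'I_n -> Omega), (2 <= n)%N -> quasi_uniform C' X ->
    fill_distance X <= C * n%:R `^ (- d%:R^-1).
Proof.
move=> d0; have d0R : 0 < d%:R :> R by rewrite ltr0n.
(* [C'] may be any real number; [|C'| + 1] dominates it and keeps the constant positive. *)
exists ((`|C'| + 1) * (d%:R * (2 * D + 1))).
  by rewrite mulr_gt0 ?ltr_wpDl // mulr_gt0 // addr_gt0 // mulr_gt0.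
move=> n X n2 [q0]; rewrite ler_pdivrMr // => h.
apply: le_trans h _; rewrite -mulrA.
apply: (@le_trans _ _ ((`|C'| + 1) * separation_distance X)).
  by rewrite ler_wpM2r ?(ltW q0) //; have := ler_norm C'; lra.
rewrite ler_wpM2l ?addr_ge0 //; exact: separation_distance_bound.
Qed.

End designs.

(** * The covariance form *)

Section covariance_form.
Context {R : realType} (d : nat) (nu : R).
Hypothesis nu0 : 0 < nu.
Local Notation mu := (@lebesgue_measure R).
Local Notation w := (log_gamma_weight nu).

(** As a function of the squared distance, which is polynomial in the coordinates, the mixture
    formula gives joint measurability by Tonelli's theorem. *)
Let radial (s : R) : R := (gamma_fun nu)^-1 * \int[mu]_v (w v * expR (- (nu * expR (- v) * s))).

Lemma measurable_radial : measurable_fun setT radial.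
Proof.
apply: measurable_funM => //.
apply: (@measurableT_comp _ _ _ _ _ _ fine); first exact: fine_measurable.
apply: (@measurable_fun_fubini_tonelli_F _ _ (measurableTypeR R) (measurableTypeR R) R mu
  (fun p : measurableTypeR R * measurableTypeR R => (w p.2 * expR (- (nu * expR (- p.2) * p.1)))%:E)).
  apply/measurable_EFinP; apply: measurable_funM.
    apply: measurableT_comp => //; apply: continuous_measurable_fun.
    exact: continuous_log_gamma_weight.
  apply: measurableT_comp => //; apply: measurableT_comp => //.
  apply: measurable_funM => //; apply: measurable_funM => //.
  by apply: measurableT_comp => //; exact: measurableT_comp.
by move=> p; rewrite lee_fin mulr_ge0 ?expR_ge0.
Qed.

Lemma matern_radial_sqr (x y : 'rV[R]_d) : matern nu x y = radial (norm2 (x - y) ^+ 2).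
Proof. by rewrite /matern matern_radialE // norm2_ge0. Qed.

Lemma measurable_matern : measurable_fun setT (fun p : 'rV[R]_d * 'rV[R]_d => matern nu p.1 p.2).
Proof.
under eq_fun do rewrite matern_radial_sqr norm2_sqr.
apply: measurableT_comp; first exact: measurable_radial.
apply: measurable_sum => i; apply: measurable_funX.
under eq_fun do rewrite mxE [X in _ + X]mxE.
apply: measurable_funB; apply: (measurableT_comp (measurable_coor i)) => //.
Qed.

Lemma norm_matern_le1 (x y : 'rV[R]_d) : `|matern nu x y| <= 1.
Proof.
have g0 := gamma_fun_gt0 nu0.
have k1 v : `|expR (- (nu * expR (- v) * norm2 (x - y) ^+ 2))| <= 1.
  rewrite ger0_norm ?expR_ge0 // -expR0 ler_expR oppr_le0.
  by rewrite mulr_ge0 ?sqr_ge0 // mulr_ge0 ?expR_ge0 // ltW.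
rewrite matern_radial_sqr /radial ger0_norm; last first.
  rewrite mulr_ge0 ?invr_ge0 ?(ltW g0) // Rintegral_ge0 // => v _.
  by rewrite mulr_ge0 ?expR_ge0.
rewrite mulrC ler_pdivrMr // mul1r gamma_funE //; apply: le_Rintegral => //.
- apply: integrable_log_gamma_weight => //.
  apply: measurableT_comp => //; apply: measurableT_comp => //.
  apply: measurable_funM => //; apply: measurable_funM => //.
  exact: measurableT_comp.
- have := @integrable_log_gamma_weight _ nu (cst 1) nu0 (measurable_cst _).
  by under eq_fun do rewrite mulr1; apply=> v; rewrite normr1.
- move=> v _; rewrite ler_piMr ?expR_ge0 //.
  by apply: le_trans (ler_norm _) (k1 v).
Qed.

Variable Omega : set 'rV[R]_d.
Hypothesis cO : compact Omega.
Local Notation lam := (lebesgue_rV d).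

Let mO : measurable Omega := compact_measurable_rV cO.

Lemma valLE (g : Omega -> R) (x : Omega) : valL_ 0 g (\val x) = g x.
Proof. have := congr1 (fun F : (Omega -> R) -> Omega -> R => F g x)
  (sigL_valL 0 : sigL Omega \o valL_ 0 = id).
by rewrite /sigL /comp set_valE. Qed.

Lemma set_val_ex (x : 'rV[R]_d) : Omega x -> exists y : Omega, \val y = x.
Proof. by move=> Ox; exists (exist _ x (mem_set Ox)). Qed.

(** The preimage of an open ray under [g] is the trace on [Omega] of an open set of the ambient
    space. *)
Lemma measurable_valL (g : Omega -> R) : continuous g -> measurable_fun Omega (valL_ 0 g).
Proof.
move=> cg mD; apply: (measurability _ (RGenOInfty.measurableE R)) => //.
move=> _ [_ [a ->] <-].
have : open (g @^-1` [set` `]a, +oo[]).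
  by apply: open_comp => //; exact: interval_open.
move=> [U oU gU].
have -> : Omega `&` valL_ 0 g @^-1` [set` `]a, +oo[] = Omega `&` U.
  apply/seteqP; split => x [Ox]; have [y <-] := set_val_ex Ox => h;
    split; try exact: set_valP_in.
    have : (g @^-1` [set` `]a, +oo[]) y by move: h; rewrite /preimage /mkset valLE.
    by rewrite -gU /preimage /mkset set_valE.
  have : (set_val @^-1` U) y by rewrite /preimage /mkset set_valE.
  by rewrite gU /preimage /mkset valLE.
by apply: measurableI => //; exact: open_measurable_rV.
Qed.

Lemma lebesgue_rV_compact_lty : (lam Omega < +oo)%E.
Proof.
have [D D0 OD] := compact_coord_bounded cO.
pose a : 'rV[R]_d := const_mx (- D); pose b : 'rV[R]_d := const_mx D.
have ab i : a ord0 i <= b ord0 i by rewrite !mxE; lra.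
pose Bx := [set x : 'rV[R]_d | forall i, a ord0 i <= x ord0 i <= b ord0 i].
have BxE : lam Bx = _ := lebesgue_rV_box ab.
have mBx : measurable Bx.
  rewrite (_ : Bx = \bigcap_(i in [set: 'I_d])
    ((fun x : 'rV[R]_d => x ord0 i : measurableTypeR R) @^-1` `[a ord0 i, b ord0 i])).
    apply: fin_bigcap_measurable => // i _; rewrite -[X in measurable X]setTI.
    by apply: measurable_coor => //; exact: measurable_itv.
  apply/seteqP; split => x /= Hx i; first by move=> _ /=; rewrite in_itv/=; exact: Hx.
  by have := Hx i I; rewrite /= in_itv.
apply: (@le_lt_trans _ _ (lam Bx)); last by rewrite BxE ltry.
apply: le_measure; rewrite ?inE // => x Ox i.
by rewrite !mxE -ler_norml; exact: OD.
Qed.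

Lemma integrable_bounded_on (F : 'rV[R]_d -> R) (K : R) : measurable_fun Omega F ->
  (forall x, Omega x -> `|F x| <= K) -> lam.-integrable Omega (EFin \o F).
Proof.
move=> mF FK; apply: measurable_bounded_integrable => //.
  exact: lebesgue_rV_compact_lty.
by exists K; split; rewrite ?num_real // => M KM x Ox; exact: le_trans (FK x Ox) (ltW KM).
Qed.

Lemma Rintegral_bounded_on (F : 'rV[R]_d -> R) (K : R) : measurable_fun Omega F ->
  (forall x, Omega x -> `|F x| <= K) ->
  `|\int[lam]_(x in Omega) F x| <= K * fine (lam Omega).
Proof.
move=> mF FK; have iF := integrable_bounded_on mF FK.
apply: le_trans (le_normr_Rintegral _ _) _ => //.
rewrite -Rintegral_cst //; apply: le_Rintegral => //.
- exact: (integrable_norm iF).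
- by apply: (@integrable_bounded_on _ `|K|).
Qed.

Let potential (h : Omega -> R) (x : 'rV[R]_d) :=
  \int[lam]_(x' in Omega) (valL_ 0 h x' * matern nu x x').

Lemma measurable_potential (h : Omega -> R) : continuous h ->
  measurable_fun Omega (potential h).
Proof.
move=> ch; apply: measurable_funTS.
apply: (@measurableT_comp _ _ _ _ _ _ fine); first exact: fine_measurable.
pose G (p : 'rV[R]_d * 'rV[R]_d) : \bar R :=
  (((valL_ 0 h) \_ Omega) p.2 * matern nu p.1 p.2)%:E.
have mG : measurable_fun setT G.
  apply/measurable_EFinP; apply: measurable_funM; last exact: measurable_matern.
  apply: measurableT_comp => //; apply/(measurable_restrictT _ _).1 => //.
  exact: measurable_valL.
(* Tonelli's theorem concerns nonnegative integrands, hence the positive and negative parts. *)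
have -> : (fun x => \int[lam]_(x' in Omega) (valL_ 0 h x' * matern nu x x')%:E)%E =
    (fun x => \int[lam]_y G^\+ (x, y) - \int[lam]_y G^\- (x, y))%E.
  apply/funext => x; rewrite integral_mkcond.
  rewrite (_ : (fun=> _) \_ Omega = (fun y => G (x, y))); last first.
    by apply/funext => y; rewrite /G !patchE; case: ifP => //; rewrite mul0r.
  rewrite integralE; congr (_ - _)%E; apply: eq_integral => y _.
    by rewrite funepos.unlock.
  by rewrite funeneg.unlock.
apply: emeasurable_funB; apply: measurable_fun_fubini_tonelli_F => //.
  exact: measurable_funepos.
exact: measurable_funeneg.
Qed.

Lemma potential_bounded (h : Omega -> R) (K : R) : continuous h -> 0 <= K ->
  (forall x, `|h x| <= K) -> forall x, `|potential h x| <= K * fine (lam Omega).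
Proof.
move=> ch K0 hK x; apply: Rintegral_bounded_on.
  apply: measurable_funM; first exact: measurable_valL.
  apply: measurable_funTS; exact: (measurable_fun_pair2 _ measurable_matern).
move=> y Oy; have [y' <-] := set_val_ex Oy; rewrite valLE normrM.
by rewrite -[K]mulr1 ler_pM // norm_matern_le1.
Qed.

Lemma matern_covE (g h : Omega -> R) (K : R) : continuous h -> (forall x, `|h x| <= K) ->
  matern_cov nu g h = \int[lam]_(x in Omega) (valL_ 0 g x * potential h x).
Proof.
move=> ch hK; apply: eq_Rintegral => x _.
under eq_Rintegral do rewrite -mulrA.
rewrite RintegralZl //; apply: (@integrable_bounded_on _ K).
  apply: measurable_funM; first exact: measurable_valL.
  apply: measurable_funTS; exact: (measurable_fun_pair2 _ measurable_matern).
move=> y Oy; have [y' <-] := set_val_ex Oy; rewrite valLE normrM.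
have K0 : 0 <= K by apply: le_trans (hK y').
by rewrite -[K]mulr1 ler_pM // norm_matern_le1.
Qed.

Lemma matern_cov_linl (a : R) (g h k : Omega -> R) (K : R) :
  continuous g -> continuous h -> continuous k ->
  (forall x, `|g x| <= K) -> (forall x, `|h x| <= K) -> (forall x, `|k x| <= K) ->
  0 <= K ->
  matern_cov nu (fun x => a * g x + h x) k = a * matern_cov nu g k + matern_cov nu h k.
Proof.
move=> cg ch ck gK hK kK K0; rewrite !(matern_covE _ ck kK).
have ip (f : Omega -> R) : continuous f -> (forall x, `|f x| <= K) ->
    lam.-integrable Omega (EFin \o (fun x => valL_ 0 f x * potential k x)).
  move=> cf fK; apply: (@integrable_bounded_on _ (K * (K * fine (lam Omega)))).
    apply: measurable_funM; first exact: measurable_valL.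
    exact: measurable_potential.
  move=> y Oy; have [y' <-] := set_val_ex Oy; rewrite valLE normrM.
  by rewrite ler_pM // potential_bounded.
have ia : lam.-integrable Omega (EFin \o (fun x => a * (valL_ 0 g x * potential k x))).
  exact: (integrableZl _ a (ip g cg gK)).
rewrite -RintegralZl //; last exact: ip.
rewrite -RintegralD //; last exact: ip.
apply: eq_Rintegral => x; rewrite inE => Ox; have [y <-] := set_val_ex Ox.
by rewrite !valLE; ring.
Qed.

Lemma matern_cov_bound (g : Omega -> R) (K : R) : continuous g -> 0 <= K ->
  (forall x, `|g x| <= K) ->
  `|matern_cov nu g g| <= K ^+ 2 * fine (lam Omega) ^+ 2.
Proof.
move=> cg K0 gK; rewrite (matern_covE _ cg gK).
have -> : K ^+ 2 * fine (lam Omega) ^+ 2 = K * (K * fine (lam Omega)) * fine (lam Omega) by ring.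
apply: Rintegral_bounded_on.
  apply: measurable_funM; first exact: measurable_valL.
  exact: measurable_potential.
move=> y Oy; have [y' <-] := set_val_ex Oy; rewrite valLE normrM.
by rewrite ler_pM // potential_bounded.
Qed.

End covariance_form.

(** * Conditional expectation as best approximation *)

Section orthogonality.
Context {disp : measure_display} {T : measurableType disp} {R : realType}.
Variable P : probability T R.
Implicit Types (D F U W X Z S : T -> R) (G : set (set T)).

Lemma integrable_le D F : measurable_fun setT F -> (forall x, `|F x| <= `|D x|) ->
  P.-integrable setT (EFin \o D) -> P.-integrable setT (EFin \o F).
Proof.
move=> mF FD; apply: le_integrable => //; first exact/measurable_EFinP.
by move=> x _; rewrite /= lee_fin.
Qed.

Lemma integrableMr_bounded D U (M : R) : P.-integrable setT (EFin \o D) ->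
  measurable_fun setT U -> (forall x, `|U x| <= M) ->
  P.-integrable setT (EFin \o (fun x => D x * U x)).
Proof.
move=> iD mU UM.
have mD : measurable_fun setT D by apply/measurable_EFinP; case/integrableP: iD.
have iMD : P.-integrable setT (EFin \o (fun x => M * D x)) by exact: (integrableZl measurableT M iD).
apply: integrable_le iMD; first exact: measurable_funM.
move=> x; rewrite !normrM mulrC ler_wpM2r //.
exact: le_trans (UM x) (ler_norm _).
Qed.

(* [U] is approximated uniformly on [0, M) by a step function with step
   [k.+1%:R^-1]. *)
Lemma orthogonal_bounded G D U (M : nat) :
  (forall A, G A -> measurable A) ->
  (forall B : set R, measurable B -> G (U @^-1` B)) ->
  P.-integrable setT (EFin \o D) ->
  (forall A, G A -> \int[P]_x (D x * \1_A x) = 0) ->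
  \int[P]_x (D x * (U x * \1_(U @^-1` `[0, M%:R[) x)) = 0.
Proof.
move=> mG GU iD D0; set A := U @^-1` _.
have mU : measurable_fun setT U by move=> _ B mB; rewrite setTI; exact/mG/GU.
have GA : G A by apply: GU; exact: measurable_itv.
have mI C : G C -> measurable_fun setT (\1_C : T -> R).
  by move=> GC; apply: measurable_indic; exact: mG.
have indic_le (C : set T) x : `|\1_C x : R| <= 1.
  by rewrite indicE; case: (_ \in _); rewrite ?normr1 ?normr0.
have mUA : measurable_fun setT (fun x => U x * \1_A x).
  by apply: measurable_funM => //; exact: mI.
have UAM x : `|U x * \1_A x| <= M%:R.
  rewrite indicE; case: (boolP (x \in A)) => [|_]; last by rewrite mulr0 normr0.
  rewrite inE /A /= in_itv/= => /andP[U0 UM]; rewrite mulr1 ger0_norm //.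
  exact: ltW.
have iDU : P.-integrable setT (EFin \o (fun x => D x * (U x * \1_A x))).
  exact: integrableMr_bounded UAM.
have ID0 : 0 <= \int[P]_x `|D x| by apply: Rintegral_ge0.
suff H k : `|\int[P]_x (D x * (U x * \1_A x))| <= k.+1%:R^-1 * \int[P]_x `|D x|.
  apply/eqP; rewrite -normr_le0; apply/ler_addgt0Pl => e e0; rewrite addr0.
  pose k := Num.truncn ((\int[P]_x `|D x|) / e).
  apply: le_trans (H k) _; rewrite ler_pdivrMl // mulrC -ler_pdivrMl //.
  by rewrite mulrC; apply/ltW; rewrite truncnS_gt.
have [r rE] : exists r : R, r = k.+1%:R^-1 by exists k.+1%:R^-1.
have r0 : 0 < r by rewrite rE invr_gt0.
have rk : r * k.+1%:R = 1 by rewrite rE mulVf.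
rewrite -rE.
pose B (j : 'I_(M * k.+1)) := U @^-1` `[j%:R * r, j.+1%:R * r[.
have GB j : G (B j) by apply: GU; exact: measurable_itv.
pose phi x := \sum_(j < M * k.+1) (j%:R * r) * \1_(B j) x.
have mphi : measurable_fun setT phi.
  apply: measurable_sum => j; apply: measurable_funM => //; exact: mI.
have close x : `|U x * \1_A x - phi x| <= r.
  have [xA|xA] := boolP (x \in A).
    have UE : U x * \1_A x = U x by rewrite indicE xA mulr1.
    move: (xA); rewrite UE inE /A /= in_itv/= => /andP[U0 UM].
    pose j := Num.truncn (U x * k.+1%:R).
    have Uk0 : 0 <= U x * k.+1%:R by rewrite mulr_ge0.
    have /andP[j1 j2] := truncn_itv Uk0.
    have jM : (j < M * k.+1)%N.
      rewrite -(ltr_nat R) natrM; apply: le_lt_trans j1 _.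
      by rewrite ltr_pM2r ?ltr0n.
    have jr1 : j%:R * r <= U x by rewrite rE ler_pdivrMr ?ltr0n.
    have jr2 : U x < j.+1%:R * r by rewrite rE ltr_pdivlMr ?ltr0n.
    rewrite /phi (bigD1 (Ordinal jM)) //= big1 ?addr0 => [|i ij].
      rewrite indicE mem_set /B /= ?in_itv/= ?jr1 ?jr2 // mulr1.
      rewrite ger0_norm ?subr_ge0 //; move: jr2; rewrite -natr1 mulrDl mul1r.
      by move=> /ltW; rewrite lerBlDl.
    rewrite indicE memNset ?mulr0 // /B /= in_itv/= => /andP[i1 i2].
    case/eqP: ij; apply/val_inj => /=; apply/eqP; rewrite eqn_leq.
    apply/andP; split; rewrite -ltnS -(ltr_nat R) -(ltr_pM2r r0).
      exact: le_lt_trans i1 jr2.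
    exact: le_lt_trans jr1 i2.
  have -> : U x * \1_A x = 0 by rewrite indicE (negPf xA) mulr0.
  rewrite /phi big1 ?subrr ?normr0 ?(ltW r0) // => j _.
  rewrite indicE memNset ?mulr0 // /B /= in_itv/= => /andP[i1 i2].
  move/negP: xA; apply; rewrite inE /A /= in_itv/=; apply/andP; split.
    by apply: le_trans i1; rewrite mulr_ge0 // ltW.
  apply: lt_le_trans i2 _; rewrite rE ler_pdivrMr ?ltr0n // -natrM ler_nat.
  exact: ltn_ord.
have iDB (j : 'I_(M * k.+1)) : P.-integrable setT (EFin \o (fun x => D x * \1_(B j) x)).
  by apply: (integrableMr_bounded iD (M := 1)); [exact: mI|exact: indic_le].
have iDj (j : 'I_(M * k.+1)) : P.-integrable setT (EFin \o (fun x => (j%:R * r) * (D x * \1_(B j) x))).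
  exact: (integrableZl measurableT _ (iDB j)).
have Dphi : \int[P]_x (D x * phi x) = 0.
  transitivity (\int[P]_x (\sum_(j < M * k.+1) (j%:R * r) * (D x * \1_(B j) x))).
    apply: eq_Rintegral => x _; rewrite mulr_sumr; apply: eq_bigr => j _; ring.
  rewrite Rintegral_sum // big1 // => j _; rewrite RintegralZl ?D0 ?mulr0 //.
have iDd : P.-integrable setT (EFin \o (fun x => D x * (U x * \1_A x - phi x))).
  by apply: integrableMr_bounded close => //; exact: measurable_funB.
have iDp : P.-integrable setT (EFin \o (fun x => D x * phi x)).
  have -> : EFin \o (fun x => D x * phi x) =
     (fun x => \sum_(j < M * k.+1) (j%:R * r * (D x * \1_(B j) x))%:E)%E.
    apply/funext => x; rewrite /= sumEFin /phi mulr_sumr; congr EFin.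
    by apply: eq_bigr => j _; ring.
  by apply: integrable_sum => // j _; exact: iDj.
have -> : \int[P]_x (D x * (U x * \1_A x)) = \int[P]_x (D x * (U x * \1_A x - phi x)).
  transitivity (\int[P]_x (D x * (U x * \1_A x - phi x) + D x * phi x)).
    by apply: eq_Rintegral => x _; ring.
  by rewrite RintegralD // Dphi addr0.
have iD' : P.-integrable setT (EFin \o (fun x => `|D x|)) by exact: integrable_norm.
apply: le_trans (le_normr_Rintegral _ _) _ => //.
rewrite -RintegralZl //; apply: le_Rintegral => //.
- exact: (integrable_norm iDd).
- exact: (integrableZl _ r iD').
- by move=> x _; rewrite normrM mulrC ler_wpM2r.
Qed.

Lemma g_sigma_preimage_measurable (n : nat) (Y : 'I_n -> T -> R) :
  (forall i, measurable_fun setT (Y i)) ->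
  forall A, g_sigma_preimage Y A -> measurable A.
Proof.
move=> mY; apply: smallest_sub; first exact: sigma_algebra_measurable.
move=> B; rewrite -bigcup_seq/= => -[i _ [C mC <-]].
by rewrite setTI; have := mY i measurableT _ mC; rewrite setTI.
Qed.

Lemma g_sigma_preimage_sub_sum (n : nat) (Y : 'I_n -> T -> R) Z (a : 'I_n -> R) :
  (forall B : set R, measurable B -> g_sigma_preimage Y (Z @^-1` B)) ->
  forall (t : R) (B : set R), measurable B ->
  g_sigma_preimage Y ((fun x => Z x - \sum_i a i * Y i x + t) @^-1` B).
Proof.
move=> GZ t B mB.
(* [T] with the sigma-algebra generated by [Y]: measurability for [Y] becomes ordinary measurability
   on [GT] and is preserved by arithmetic. *)
pose GT := g_sigma_algebraType (\big[setU/set0]_(i < n)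
  preimage_set_system setT (Y i) (@measurable _ (measurableTypeR R))).
have mZ : measurable_fun (setT : set GT) (Z : GT -> measurableTypeR R).
  by move=> _ C mC; rewrite setTI; exact: GZ.
have mY i : measurable_fun (setT : set GT) (Y i : GT -> measurableTypeR R).
  move=> _ C mC; rewrite setTI; apply: sub_sigma_algebra.
  rewrite -bigcup_seq/=; exists i; first by rewrite /= mem_index_enum.
  by exists C => //; rewrite setTI.
have mF : measurable_fun (setT : set GT)
    ((fun x => Z x - \sum_i a i * Y i x + t) : GT -> measurableTypeR R).
  apply: measurable_funD => //; apply: measurable_funB => //.
  by apply: measurable_sum => i; apply: measurable_funM; [exact: measurable_cst|exact: mY].
by have := mF measurableT _ mB; rewrite setTI.
Qed.

(* [Z] is not assumed to be square integrable: [W = Z - S] is first truncated to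
   [-M, M), where it is orthogonal to [X - Z]. *)
Lemma cond_expectation_best (n : nat) (Y : 'I_n -> T -> R) X Z (a : 'I_n -> R) :
  (forall i, measurable_fun setT (Y i)) ->
  P.-integrable setT (EFin \o X) ->
  cond_expectation P Y X Z ->
  P.-integrable setT (EFin \o (fun w => (X w - \sum_i a i * Y i w) ^+ 2)) ->
  (\int[P]_w ((X w - Z w) ^+ 2)%:E <=
   \int[P]_w ((X w - \sum_i a i * Y i w) ^+ 2)%:E)%E.
Proof.
move=> mY iX [iZ GZ ZX] iXS.
pose S w := \sum_i a i * Y i w.
pose D w := X w - Z w; pose W w := Z w - S w.
have mX : measurable_fun setT X by apply/measurable_EFinP; case/integrableP: iX.
have mZ : measurable_fun setT Z by apply/measurable_EFinP; case/integrableP: iZ.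
have mS : measurable_fun setT S.
  by apply: measurable_sum => i; apply: measurable_funM.
have mG := g_sigma_preimage_measurable mY.
have iD : P.-integrable setT (EFin \o D).
  by have := integrableB measurableT iX iZ; apply: eq_integrable.
have D0 A : g_sigma_preimage Y A -> \int[P]_x (D x * \1_A x) = 0.
  move=> GA; have mA := mG _ GA.
  have mkI (F : T -> R) : \int[P]_x (F x * \1_A x) = \int[P]_(x in A) F x.
    by rewrite [RHS]Rintegral_mkcond; apply: eq_Rintegral => x _;
      rewrite patchE indicE; case: ifP => _; rewrite ?mulr1 ?mulr0.
  rewrite mkI RintegralB //; last 2 first.
  - exact: integrableS iX.
  - exact: integrableS iZ.
  by rewrite /Rintegral ZX // subrr.
(* The event that [W] lies in [-M, M). It is written with the nonnegative truncation of [W + M] so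
   that [orthogonal_bounded] applies; the shift is removed afterwards using the orthogonality of [D]
   to indicators. *)
pose A (M : nat) := (fun x => W x + M%:R) @^-1` `[0, (M + M)%:R[.
have GA M : g_sigma_preimage Y (A M).
  by apply: g_sigma_preimage_sub_sum GZ _ _ _; exact: measurable_itv.
have mA M : measurable (A M) by exact: mG.
have indic_le (C : set T) x : `|\1_C x : R| <= 1.
  by rewrite indicE; case: (_ \in _); rewrite ?normr1 ?normr0.
have mI M : measurable_fun setT (\1_(A M) : T -> R) by exact: measurable_indic.
have WA M x : `|W x * \1_(A M) x| <= M%:R.
  rewrite indicE; case: (boolP (x \in A M)) => [|_]; last by rewrite mulr0 normr0.
  rewrite inE /A /= in_itv/= natrD => /andP[U0 UM]; rewrite mulr1 ler_norml.
  by apply/andP; split; lra.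
have mW : measurable_fun setT W by exact: measurable_funB.
have iDW M : P.-integrable setT (EFin \o (fun x => D x * (W x * \1_(A M) x))).
  by apply: integrableMr_bounded (WA M) => //; exact: measurable_funM.
have DW M : \int[P]_x (D x * (W x * \1_(A M) x)) = 0.
  have GU B : measurable B -> g_sigma_preimage Y ((fun x => W x + M%:R) @^-1` B).
    exact: g_sigma_preimage_sub_sum.
  have := orthogonal_bounded (M + M) mG GU iD D0.
  rewrite -/(A M) => h.
  transitivity (\int[P]_x (D x * ((W x + M%:R) * \1_(A M) x) - M%:R * (D x * \1_(A M) x))).
    by apply: eq_Rintegral => x _; ring.
  have i1 : P.-integrable setT (EFin \o (fun x => D x * \1_(A M) x)).
    by apply: (integrableMr_bounded iD (M := 1)).
  have i2 : P.-integrable setT (EFin \o (fun x => M%:R * (D x * \1_(A M) x))).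
    exact: (integrableZl _ M%:R i1).
  rewrite RintegralB //; last first.
    have := integrableD measurableT (iDW M) i2; apply: eq_integrable => // x _ /=.
    by rewrite -EFinD; congr EFin; ring.
  by rewrite h RintegralZl // D0 // mulr0 subrr.
have mD : measurable_fun setT D by exact: measurable_funB.
have mD2 : measurable_fun setT (fun x => D x ^+ 2) by exact: measurable_funX.
(* On [A M], [X - S = D + W] and dropping [W ^+ 2] leaves [D ^+ 2 + 2 * (D * W)], whose cross term
   integrates to 0. Monotone convergence in [M] then removes the truncation. *)
have step M : (\int[P]_(w in A M) (D w ^+ 2)%:E <=
    \int[P]_w ((X w - S w) ^+ 2)%:E)%E.
  have iq : P.-integrable setT (EFin \o (fun x => (X x - S x) ^+ 2 - 2 * (D x * (W x * \1_(A M) x)))).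
    have i2 := integrableZl measurableT 2 (iDW M).
    by have := integrableB measurableT iXS i2; apply: eq_integrable.
  rewrite integral_mkcond.
  apply: (@le_trans _ _ (\int[P]_x ((X x - S x) ^+ 2 - 2 * (D x * (W x * \1_(A M) x)))%:E)%E).
    apply: ge0_le_integral => //.
    - by move=> x _; rewrite patchE; case: ifP => // _; rewrite lee_fin sqr_ge0.
    - apply/(measurable_restrictT _ _).1 => //.
      by apply/measurable_EFinP; exact: measurable_funTS.
    - by case/integrableP: iq.
    move=> x _; rewrite patchE indicE; case: ifP => _; rewrite lee_fin.
      rewrite mulr1 -subr_ge0.
      have -> : (X x - S x) ^+ 2 - 2 * (D x * W x) - D x ^+ 2 = W x ^+ 2.
        by rewrite /D /W; ring.
      exact: sqr_ge0.
    by rewrite mulr0n !mulr0 subr0 sqr_ge0.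
  have fE : (\int[P]_x ((X x - S x) ^+ 2 - 2 * (D x * (W x * \1_(A M) x)))%:E)%E =
     (\int[P]_x ((X x - S x) ^+ 2 - 2 * (D x * (W x * \1_(A M) x))))%:E.
    by rewrite fineK //; exact: integrable_fin_num iq.
  rewrite fE RintegralB //; last exact: (integrableZl measurableT 2 (iDW M)).
  rewrite RintegralZl // DW mulr0 subr0 fineK //.
  exact: integrable_fin_num iXS.
have AT : \bigcup_M A M = setT.
  apply/seteqP; split => // x _; exists (Num.truncn `|W x|).+1 => //.
  rewrite /A /= in_itv/= natrD; have := truncnS_gt `|W x|.
  rewrite ltr_norml => /andP[h1 h2]; apply/andP; split; lra.
have cv : (\int[P]_(w in A M) (D w ^+ 2)%:E)%E @[M --> \oo] -->
    (\int[P]_w (D w ^+ 2)%:E)%E.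
  rewrite -AT; apply: ge0_nondecreasing_set_cvg_integral => //.
  - move=> m k mk; apply/subsetPset => x; rewrite /A /= !in_itv/= !natrD.
    have : m%:R <= k%:R :> R by rewrite ler_nat.
    by lra.
  - by move=> i; apply/measurable_EFinP; exact: measurable_funTS.
  - by move=> i x _; rewrite lee_fin sqr_ge0.
rewrite -(cvg_lim _ cv) //; apply: lime_le; first by apply/cvg_ex; eexists; exact: cv.
by near=> M; exact: step.
Unshelve. all: by end_near. Qed.

End orthogonality.

(** * The error bound *)

Section power_function.
Context {R : realType} (d : nat) (Omega : set 'rV[R]_d) (D nu : R).
Hypothesis nu0 : 0 < nu.
Hypothesis D0 : 0 < D.
Hypothesis OD : forall x i, Omega x -> `|x ord0 i| <= D.
Hypothesis cO : convex_set Omega.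
Variables (c : 'rV[R]_d) (rho : R).
Hypothesis rho0 : 0 < rho.
Hypothesis cube : forall x : 'rV[R]_d,
  (forall i, `|x ord0 i - c ord0 i| <= rho) -> Omega x.

Lemma matern_diag (x : 'rV[R]_d) : matern nu x x = 1.
Proof.
rewrite /matern subrr /norm2 big1 ?sqrtr0 => [|i _]; last by rewrite mxE expr0n.
by rewrite /matern_radial eqxx.
Qed.

Lemma sum_option (J : finType) (F : option J -> R) :
  \sum_a F a = F None + \sum_j F (Some j).
Proof.
rewrite (bigD1 None) //=; congr (_ + _).
rewrite (reindex_omap Some id) //=; last by case.
by apply: eq_bigl => j; rewrite eqxx.
Qed.

(** With [residual_node] below, this encodes the functional $\delta_x-\sum_j
    u_j\delta_{x_{\mathrm{idx}(j)}}$, where [None] stands for [x]. Several indices [j] may share one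
    design point. *)
Definition residual_coef (J : Type) (u : J -> R) (a : option J) : R :=
  if a is Some j then - u j else 1.

Definition residual_node (J : Type) (n : nat) (X : 'I_n -> Omega) (x : Omega)
    (idx : J -> 'I_n) (a : option J) : Omega :=
  if a is Some j then X (idx j) else x.

(* When the fill distance [h] is at most [h0], shrinking the cube towards [x] by
   the factor [h / h0] keeps it inside [Omega] by convexity, and the design points
   nearest to the nodes of a grid in the small cube form, after rescaling, a small
   perturbation of the fixed grid. They reproduce polynomials at [x], with
   coefficients bounded independently of [x] and of the design. *)
Lemma power_function_bound : exists2 C : R, 0 <= C &
  forall n (X : 'I_n -> Omega) (x : Omega), (0 < n)%N ->
  exists (J : finType) (u : J -> R) (idx : J -> 'I_n),
  \sum_a \sum_b residual_coef u a * residual_coef u b *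
    matern nu (\val (residual_node X x idx a)) (\val (residual_node X x idx b)) <=
  C * fill_distance X `^ (2 * nu).
Proof.
(* The order required by [matern_quad_bound]. The Taylor polynomial is taken in the squared
   distance, so degrees below [m.*2] must be killed, whence [m.*2] nodes in each direction. *)
pose m := (Num.truncn (2 * nu)).+1.
have num : 2 * nu <= m%:R by apply/ltW; rewrite truncnS_gt.
have m20 : (0 < m.*2)%N by rewrite double_gt0.
have [e [M [e0 M0 lpr]]] := @local_polynomial_reproduction R d _ m20 (2 * D / rho).
(* With this threshold a displacement by [h] in the cube shrunk by [h / h0] becomes, after
   rescaling, one by [e / 2], within the tolerance of the reproduction lemma. *)
pose h0 := rho * (e / 2).
have h00 : 0 < h0 by rewrite mulr_gt0 // divr_gt0.
(* A chosen design point is within [h] of its node, and the node within [(h / h0) * (2 * D + rho)]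
   of [x], in each coordinate. *)
pose kap := 1 + (2 * D + rho) / h0.
have kap0 : 0 <= kap by rewrite addr_ge0 // divr_ge0 ?addr_ge0 ?mulr_ge0 // ltW.
pose B := (d%:R * (2 * kap)) ^+ 2.
have B0 : 0 <= B by rewrite sqr_ge0.
pose C1 := (gamma_fun nu)^-1 * ((1 + M) ^+ 2 * Num.max 1 ((nu * B) ^+ m) * (2 / nu)).
have C10 : 0 <= C1.
  rewrite mulr_ge0 ?invr_ge0 ?(ltW (gamma_fun_gt0 nu0)) //.
  by rewrite mulr_ge0 ?divr_ge0 ?(ltW nu0) // mulr_ge0 ?sqr_ge0 // le_max ler01.
(* [C1] serves fill distances up to [h0]. Beyond [h0] the functional $\delta_x$ alone, with
   quadratic form 1, is enough, as $1\le (h/h_0)^{2\nu}$. *)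
exists (C1 + h0 `^ (- (2 * nu))); first by rewrite addr_ge0 // powR_ge0.
move=> n X x n0; set h := fill_distance X.
have hge0 : 0 <= h := fill_distance_ge0 OD X n0.
have hp0 : 0 <= h `^ (2 * nu) by exact: powR_ge0.
have Ox := set_valP_in x.
(* For [h = 0] the rescaling degenerates, but [x] is then itself a design point and the functional
   can be taken to be zero. *)
have [hz|hpos] := eqVneq h 0.
  have [j xj] := fill_distance_attained OD X n0 Ox.
  exists unit, (fun=> 1), (fun=> j).
  have zE a : \val (residual_node X x (fun _ : unit => j) a) = \val x.
    case: a => //= _; apply/rowP => i; apply/eqP; rewrite eq_sym -subr_eq0 -normr_le0.
    have := coord_le_norm2 (\val x - \val (X j)) i; rewrite !mxE.
    by move=> /le_trans; apply; rewrite -hz.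
  under eq_bigr do under eq_bigr do rewrite !zE matern_diag mulr1.
  under eq_bigr do rewrite -mulr_sumr.
  rewrite -mulr_suml sum_option (big_pred1 tt) //=.
  by rewrite subrr mul0r mulr_ge0 // addr_ge0 // powR_ge0.
have {hpos} h_gt0 : 0 < h by rewrite lt_neqAle eq_sym hpos.
have [hh0|hh0] := leP h h0; last first.
  exists 'I_0, (fun=> 0), (fun=> Ordinal n0).
  rewrite (big_pred1 None) => [|[[]|]] //; rewrite (big_pred1 None) => [|[[]|]] //.
  rewrite [X in X <= _](_ : _ = 1); last by rewrite matern_diag !mulr1.
  apply: (@le_trans _ _ (h0 `^ (- (2 * nu)) * h `^ (2 * nu))).
    rewrite powRN mulrC ler_pdivlMr ?powR_gt0 // mul1r.
    by apply: ge0_ler_powR; rewrite ?nnegrE ?mulr_ge0 // ltW.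
  by rewrite ler_wpM2r // lerDr.
pose th := h / h0.
have th0 : 0 < th by rewrite divr_gt0.
have th1 : th <= 1 by rewrite ler_pdivrMr // mul1r.
pose grid := {ffun 'I_d -> 'I_(m.*2)}.
pose p (a : grid) : 'rV[R]_d := th *: (c + rho *: grid_node a) + (1 - th) *: \val x.
have t01 (a : grid) i : 0 <= (node m.*2 (a i) : R) <= 1.
  rewrite /node divr_ge0 //= ler_pdivrMr ?ltr0n // mul1r ler_nat.
  exact: ltnW (ltn_ord _).
have Op a : Omega (p a).
  apply: convex_setP => //; last exact: ltW.
  apply: cube => i; rewrite !mxE addrAC subrr add0r.
  have /andP[t0 t1] := t01 a i.
  by rewrite normrM !ger0_norm ?(ltW rho0) // ler_piMr // ltW.
have /choice[idx hidx] a := fill_distance_attained OD X n0 (Op a).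
(* The affine map that undoes the shrinking: it sends [p a] to [grid_node a] and [x] to
   $(x-c)/\rho$. *)
pose L (z : 'rV[R]_d) : 'rV[R]_d :=
  (th * rho)^-1 *: (z - \val x - th *: (c - \val x)).
have thr0 : 0 < th * rho by rewrite mulr_gt0.
have Lw i : `|L (\val x) ord0 i| <= 2 * D / rho.
  rewrite !mxE; have -> : (th * rho)^-1 * (\val x ord0 i - \val x ord0 i -
      th * (c ord0 i - \val x ord0 i)) = (\val x ord0 i - c ord0 i) / rho.
    by field; rewrite !lt0r_neq0.
  rewrite normrM [X in _ * X]ger0_norm ?invr_ge0 ?(ltW rho0) //.
  rewrite ler_wpM2r ?invr_ge0 ?(ltW rho0) //.
  have Oc : Omega c by apply: cube => j; rewrite subrr normr0 ltW.
  apply: le_trans (ler_normB _ _) _.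
  by have := OD i Ox; have := OD i Oc; lra.
have hp a i : `|p a ord0 i - \val (X (idx a)) ord0 i| <= h.
  have -> : p a ord0 i - \val (X (idx a)) ord0 i = (p a - \val (X (idx a))) ord0 i.
    by rewrite [RHS]mxE; congr (_ + _); rewrite [RHS]mxE.
  by apply: le_trans (hidx a); exact: coord_le_norm2.
have Lxi a i : `|L (\val (X (idx a))) ord0 i - node m.*2 (a i)| < e.
  have -> : L (\val (X (idx a))) ord0 i - node m.*2 (a i) =
      (th * rho)^-1 * (\val (X (idx a)) ord0 i - p a ord0 i).
    by rewrite !mxE; field; rewrite !lt0r_neq0.
  rewrite normrM ger0_norm ?invr_ge0 ?(ltW thr0) // distrC.
  rewrite mulrC ltr_pdivrMr //; apply: le_lt_trans (hp a i) _.
  have -> : e * (th * rho) = 2 * h by rewrite /th /h0; field; rewrite !lt0r_neq0.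
  lra.
have [u uM uE] := lpr (fun a => L (\val (X (idx a)))) (L (\val x)) Lxi Lw.
exists grid, u, idx.
pose z a := \val (residual_node X x idx a).
have zx a i : `|z a ord0 i - \val x ord0 i| <= kap * h.
  case: a => [a|] /=; last by rewrite subrr normr0 mulr_ge0.
  have -> : z (Some a) ord0 i - \val x ord0 i =
     (\val (X (idx a)) ord0 i - p a ord0 i) + (p a ord0 i - \val x ord0 i).
    by rewrite /z /=; ring.
  apply: le_trans (ler_normD _ _) _.
  have -> : kap * h = h + th * (2 * D + rho) by rewrite /kap /th; ring.
  apply: lerD; first by rewrite distrC.
  have -> : p a ord0 i - \val x ord0 i =
      th * (c ord0 i - \val x ord0 i + rho * node m.*2 (a i)).
    by rewrite !mxE; ring.
  rewrite normrM ger0_norm ?(ltW th0) // ler_wpM2l ?(ltW th0) //.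
  apply: le_trans (ler_normD _ _) _; apply: lerD.
    have Oc : Omega c by apply: cube => j; rewrite subrr normr0 ltW.
    apply: le_trans (ler_normB _ _) _.
    by have := OD i Ox; have := OD i Oc; lra.
  have /andP[t0 t1] := t01 a i.
  by rewrite normrM !ger0_norm ?(ltW rho0) // ler_piMr // ltW.
have zz a b : norm2 (z a - z b) ^+ 2 <= B * h ^+ 2.
  rewrite /B -exprMn lerXn2r ?nnegrE ?norm2_ge0 ?mulr_ge0 //.
  rewrite -mulrA; apply: norm2_le => i.
  have -> : (z a - z b) ord0 i =
    (z a ord0 i - \val x ord0 i) - (z b ord0 i - \val x ord0 i).
    by rewrite [LHS]mxE [X in _ + X = _]mxE; ring.
  apply: le_trans (ler_normB _ _) _.
  by have := zx a i; have := zx b i; lra.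
have kz : kills (residual_coef u) z m.*2.
  move=> q sq; rewrite sum_option /= mul1r.
  (* Each factor is composed with the inverse of [L] in its coordinate; this preserves the degree,
     so reproduction in rescaled coordinates is reproduction in the original ones. *)
  pose q' i : {poly R} := q i \Po ((th * rho) *: 'X +
    (\val x ord0 i + th * (c ord0 i - \val x ord0 i))%:P).
  have q'E (y : 'rV[R]_d) i : (q' i).[L y ord0 i] = (q i).[y ord0 i].
    rewrite /q' horner_comp hornerD hornerZ hornerX hornerC; congr (_.[_]).
    by rewrite !mxE; field; rewrite !lt0r_neq0.
  have sq' i : (size (q' i) <= m.*2)%N.
    apply: leq_trans (sq i); rewrite /q' size_comp_poly2 //.
    rewrite size_polyDl ?size_scale ?lt0r_neq0 ?size_polyX //.
    by rewrite (leq_ltn_trans (size_polyC_leq1 _)).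
  have -> : \prod_i (q i).[z None ord0 i] = \prod_i (q' i).[L (\val x) ord0 i].
    by apply: eq_bigr => i _; rewrite q'E.
  rewrite -uE // -big_split big1 //= => a _; rewrite mulNr.
  have -> : \prod_i (q i).[z (Some a) ord0 i] =
      \prod_i (q' i).[L (\val (X (idx a))) ord0 i].
    by apply: eq_bigr => i _; rewrite q'E.
  exact: addrN.
have cM : \sum_a `|residual_coef u a| <= 1 + M.
  by rewrite sum_option normr1 lerD2l; under eq_bigr do rewrite normrN.
apply: le_trans (ler_norm _) _.
apply: le_trans (matern_quad_bound nu0 num kz cM B0 h_gt0 zz) _.
by rewrite -/C1 ler_wpM2r // lerDl powR_ge0.
Qed.

End power_function.

(** * Second moments of linear combinations *)

Section second_moments.
Context {disp : measure_display} {T : measurableType disp} {R : realType}.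
Variable P : probability T R.

Lemma covariance_centered (X Y : T -> R) : ('E_P[X] = 0)%E -> ('E_P[Y] = 0)%E ->
  covariance P X Y = (\int[P]_w (X w * Y w)%:E)%E.
Proof.
move=> EX EY; rewrite covariance.unlock EX EY expectation.unlock /=.
by apply: eq_integral => w _; rewrite -[LHS]/(((X w - 0) * (Y w - 0))%:E) !subr0.
Qed.

(** Finite diagonal moments give square integrability, hence integrable products, which allows the
    square to be expanded under the integral. *)
Lemma second_moment_sum (I : Type) (s : seq I) (b : I -> R) (X : I -> T -> R)
    (c : I -> I -> R) :
  (forall i, measurable_fun setT (X i)) ->
  (forall i j, (\int[P]_w (X i w * X j w)%:E = (c i j)%:E)%E) ->
  P.-integrable setT (EFin \o (fun w => (\sum_(i <- s) b i * X i w) ^+ 2)) /\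
  (\int[P]_w ((\sum_(i <- s) b i * X i w) ^+ 2)%:E =
    (\sum_(i <- s) \sum_(j <- s) b i * b j * c i j)%:E)%E.
Proof.
move=> mX Xc.
have mXX i j : measurable_fun setT (fun w => X i w * X j w) by exact: measurable_funM.
have iX2 i : P.-integrable setT (EFin \o (fun w => X i w * X i w)).
  apply/integrableP; split; first exact/measurable_EFinP.
  under eq_integral do rewrite gee0_abs ?lee_fin -?expr2 ?sqr_ge0 //.
  by rewrite Xc ltry.
have iXX i j : P.-integrable setT (EFin \o (fun w => X i w * X j w)).
  have iD : P.-integrable setT (EFin \o (fun w => X i w * X i w + X j w * X j w)).
    by have := integrableD measurableT (iX2 i) (iX2 j); apply: eq_integrable.
  apply: integrable_le iD => // w.
  rewrite [leRHS]ger0_norm ?addr_ge0 // -?expr2 ?sqr_ge0 // ler_norml.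
  by apply/andP; split; have := sqr_ge0 (X i w - X j w);
    have := sqr_ge0 (X i w + X j w); nra.
have ibXX i j : P.-integrable setT (EFin \o (fun w => b i * b j * (X i w * X j w))).
  exact: (integrableZl measurableT (b i * b j) (iXX i j)).
have isum i : P.-integrable setT (EFin \o (fun w => \sum_(j <- s) b i * b j * (X i w * X j w))).
  have -> : EFin \o (fun w => \sum_(j <- s) b i * b j * (X i w * X j w)) =
      (fun w => \sum_(j <- s) (b i * b j * (X i w * X j w))%:E)%E.
    by apply/funext => w; rewrite /= sumEFin.
  by apply: integrable_sum => // j _; exact: ibXX.
have sqE w : (\sum_(i <- s) b i * X i w) ^+ 2 =
    \sum_(i <- s) \sum_(j <- s) b i * b j * (X i w * X j w).
  rewrite expr2 mulr_suml; apply: eq_bigr => i _.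
  by rewrite mulr_sumr; apply: eq_bigr => j _; ring.
have iS : P.-integrable setT (EFin \o (fun w => (\sum_(i <- s) b i * X i w) ^+ 2)).
  have -> : EFin \o (fun w => (\sum_(i <- s) b i * X i w) ^+ 2) =
      (fun w => \sum_(i <- s) (\sum_(j <- s) b i * b j * (X i w * X j w))%:E)%E.
    by apply/funext => w; rewrite /= sqE sumEFin.
  by apply: integrable_sum => // i _; exact: isum.
split=> //; rewrite -[LHS]fineK; last exact: integrable_fin_num iS.
congr EFin; transitivity (\int[P]_w (\sum_(i <- s) \sum_(j <- s) b i * b j * (X i w * X j w))).
  by apply: eq_Rintegral => w _; exact: sqE.
rewrite Rintegral_sum //; apply: eq_bigr => i _.
rewrite (Rintegral_sum _ _ (ibXX i)) //; apply: eq_bigr => j _.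
by rewrite RintegralZl // /Rintegral Xc.
Qed.

End second_moments.

(** * The mean square prediction error *)

Section kriging.
Context {R : realType} (d : nat) (Omega : set 'rV[R]_d) (nu : R)
  (V : set (Omega -> R)) (H : rkhs (@matern_on R d Omega nu))
  {disp : measure_display} {T : measurableType disp} (P : probability T R)
  (f : (Omega -> R) -> {RV P >-> R}).
Hypothesis cO : compact Omega.
Hypothesis nu0 : 0 < nu.
Hypothesis Vc : V `<=` [set g : Omega -> R | continuous g].
Hypothesis HV : rkhs_set H `<=` V.
Hypothesis fP : centered_gaussian_process V (@matern_cov R d Omega nu) f.

Let S := rkhs_set H.
Let dot := rkhs_dot H.
Let ker (x : Omega) : Omega -> R := fun y => matern_on nu y x.
Let N := rkhs_norm H.

Lemma rkhs_form : form_on S dot.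
Proof.
split; [exact: rkhs_zero|exact: rkhs_lin|exact: rkhs_dotC|exact: rkhs_dot_lin].
Qed.

Lemma rkhs_dot_ge0 g : S g -> 0 <= dot g g.
Proof.
move=> Sg; have [->|/eqP g0] := pselect (g = fun=> 0).
  by rewrite (form_dot0l rkhs_form) //; exact: rkhs_zero.
by apply/ltW/rkhs_dot_gt0 => //; exact/eqP.
Qed.

Lemma rkhs_norm_sqr g : S g -> N g ^+ 2 = dot g g.
Proof. by move=> Sg; rewrite sqr_sqrtr // rkhs_dot_ge0. Qed.

Lemma rkhs_dot_ker g x : S g -> dot g (ker x) = g x.
Proof. by move=> Sg; rewrite [RHS](rkhs_reproducing x Sg). Qed.

Lemma rkhs_kernel_dot x y : dot (ker x) (ker y) = matern nu (\val x) (\val y).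
Proof.
rewrite (form_C rkhs_form) //; try exact: rkhs_kernel.
by rewrite rkhs_dot_ker //; exact: rkhs_kernel.
Qed.

(** Cauchy-Schwarz against the kernel section at [x], which has norm 1. *)
Lemma rkhs_sup_norm g x : S g -> `|g x| <= N g.
Proof.
move=> Sg; have Sk : S (ker x) := rkhs_kernel H x.
have := form_cauchy_schwarz rkhs_form rkhs_dot_ge0 Sg Sk.
rewrite rkhs_kernel_dot matern_diag mulr1 (rkhs_dot_ker x Sg).
rewrite -rkhs_norm_sqr // -[leLHS]real_normK ?num_real //.
by rewrite ler_sqr ?nnegrE ?sqrtr_ge0.
Qed.

Lemma rkhs_continuous g : S g -> continuous g.
Proof. by move=> Sg; exact/Vc/HV. Qed.

Lemma process_mean g : S g -> ('E_P[f g] = 0)%E.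
Proof. by move=> Sg; case: fP => _ + _; apply; exact: HV. Qed.

Lemma process_cov g h : S g -> S h ->
  (\int[P]_w (f g w * f h w)%:E = (matern_cov nu g h)%:E)%E.
Proof.
move=> Sg Sh; rewrite -covariance_centered; try exact: process_mean.
by case: fP => _ _; apply; exact: HV.
Qed.

Lemma matern_cov_form : form_on S (matern_cov nu).
Proof.
split; [exact: rkhs_zero|exact: rkhs_lin| |].
  (* Symmetry is read off the second moments of the process instead of exchanging the two
     integrals. *)
  move=> g h Sg Sh; apply/EFin_inj; rewrite -!process_cov //.
  by apply: eq_integral => w _; rewrite mulrC.
move=> a g h k Sg Sh Sk.
have N0 g' : 0 <= N g' by exact: sqrtr_ge0.
apply: (@matern_cov_linl _ _ _ nu0 _ cO _ _ _ _ (N g + N h + N k)); try exact: rkhs_continuous.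
- by move=> x; apply: le_trans (rkhs_sup_norm x Sg) _; have := N0 h; have := N0 k; lra.
- by move=> x; apply: le_trans (rkhs_sup_norm x Sh) _; have := N0 g; have := N0 k; lra.
- by move=> x; apply: le_trans (rkhs_sup_norm x Sk) _; have := N0 h; have := N0 g; lra.
- by rewrite !addr_ge0.
Qed.

(** [r] below represents the residual functional in the native space. Pairing it with [e] leaves
    only the evaluation at [x], and its squared norm is the kernel quadratic form. *)
Lemma orthogonal_residual_le (n : nat) (X : 'I_n -> Omega) (J : finType)
    (u : J -> R) (idx : J -> 'I_n) (e : Omega -> R) (x : Omega) :
  S e -> (forall j, e (X j) = 0) ->
  e x ^+ 2 <= dot e e * \sum_a \sum_b residual_coef u a * residual_coef u b *
    matern nu (\val (residual_node X x idx a)) (\val (residual_node X x idx b)).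
Proof.
move=> Se eX.
pose z := residual_node X x idx.
pose r y := \sum_a residual_coef u a * ker (z a) y.
have Sk a : S (ker (z a)) by exact: rkhs_kernel.
have Sr : S r by exact: (form_sum rkhs_form).
have <- : dot e r = e x.
  rewrite (form_C rkhs_form) // (form_dot_suml rkhs_form) // sum_option big1 => [|j _].
    by rewrite addr0 mul1r (form_C rkhs_form) // rkhs_dot_ker.
  by rewrite (form_C rkhs_form) // rkhs_dot_ker // eX mulr0.
have <- : dot r r = \sum_a \sum_b residual_coef u a * residual_coef u b *
    matern nu (\val (z a)) (\val (z b)).
  rewrite (form_dot_sum rkhs_form) //; apply: eq_bigr => a _; apply: eq_bigr => b _.
  by rewrite rkhs_kernel_dot.
exact: form_cauchy_schwarz rkhs_form rkhs_dot_ge0 _ _ Se Sr.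
Qed.

(** The native-space projection coefficients [a] are reused as those of a linear predictor. [f]
    carries no linear structure in its index, so the link is made through second moments: their
    expansion matches that of [matern_cov nu e e] by bilinearity. *)
Lemma kriging_error (n : nat) (X : 'I_n -> Omega) (g : Omega -> R) (fhat : T -> R)
    (Q : R) : 0 <= Q -> S g ->
  (forall x : Omega, exists (J : finType) (u : J -> R) (idx : J -> 'I_n),
    \sum_a \sum_b residual_coef u a * residual_coef u b *
      matern nu (\val (residual_node X x idx a)) (\val (residual_node X x idx b)) <= Q) ->
  cond_expectation P (fun j => f (fun x => matern_on nu x (X j))) (f g) fhat ->
  ('E_P[(fun w => (f g w - fhat w) ^+ 2)%R] <=
    (Q * fine (lebesgue_rV d Omega) ^+ 2 * N g ^+ 2)%:E)%E.
Proof.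
move=> Q0 Sg hQ fhatP.
pose v j := ker (X j).
have Sv j : S (v j) by exact: rkhs_kernel.
have [a ha] := form_projection rkhs_form rkhs_dot_ge0 Sv Sg.
pose s x := \sum_j a j * v j x; pose e x := g x - s x.
have Ss : S s by exact: (form_sum rkhs_form).
have Se : S e by exact: (form_sub rkhs_form).
have eX j : e (X j) = 0 by rewrite -(rkhs_dot_ker (X j) Se); exact: ha.
have es : dot e s = 0.
  rewrite (form_C rkhs_form) // (form_dot_suml rkhs_form) // big1 // => j _.
  by rewrite (form_C rkhs_form) // ha mulr0.
have ee : dot e e <= dot g g := form_projection_le rkhs_form rkhs_dot_ge0 Sg Ss es.
pose K := Num.sqrt (dot g g * Q).
have eK x : `|e x| <= K.
  rewrite -sqrtr_sqr ler_wsqrtr //.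
  have [J [u [idx uQ]]] := hQ x.
  apply: le_trans (orthogonal_residual_le u idx x Se eX) _.
  apply: le_trans (ler_wpM2l (rkhs_dot_ge0 Se) uQ) _.
  by rewrite ler_wpM2r.
have covK : matern_cov nu e e <= Q * fine (lebesgue_rV d Omega) ^+ 2 * N g ^+ 2.
  apply: le_trans (ler_norm _) _.
  apply: le_trans (matern_cov_bound nu0 cO (rkhs_continuous Se) (sqrtr_ge0 _) eK) _.
  rewrite sqr_sqrtr ?mulr_ge0 ?rkhs_dot_ge0 // rkhs_norm_sqr //.
  by rewrite le_eqVlt; apply/orP; left; apply/eqP; ring.
(* Indexed like [residual_coef], so that [e] and the prediction error are the same combination of
   the [G o] and of the [f (G o)]. *)
pose G o := if o is Some j then v j else g.
have SG o : S (G o) by case: o => [j|]; [exact: Sv|].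
have [iS ES] := second_moment_sum (index_enum (option 'I_n)) (residual_coef a)
  (fun o => @measurable_funPT _ _ _ _ (f (G o)))
  (fun o o' => process_cov (SG o) (SG o')).
have sumE w : \sum_o residual_coef a o * f (G o) w = f g w - \sum_j a j * f (v j) w.
  rewrite sum_option /= mul1r -sumrN; congr (_ + _).
  by apply: eq_bigr => j _; rewrite mulNr.
have eE : e = fun x => \sum_o residual_coef a o * G o x.
  apply/funext => x; rewrite sum_option /= mul1r /e /s -sumrN; congr (_ + _).
  by apply: eq_bigr => j _; rewrite mulNr.
have iX : P.-integrable setT (EFin \o f g).
  have mf : measurable_fun setT (f g) by exact: measurable_funPT.
  have i1 : P.-integrable setT (EFin \o cst (1 : R)) by exact: finite_measure_integrable_cst.
  have i2 : P.-integrable setT (EFin \o (fun w => f g w * f g w)).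
    apply/integrableP; split; first by apply/measurable_EFinP; exact: measurable_funM.
    under eq_integral do rewrite gee0_abs ?lee_fin -?expr2 ?sqr_ge0 //.
    by rewrite process_cov // ltry.
  have i3 : P.-integrable setT (EFin \o (fun w => 1 + f g w * f g w)).
    by have := integrableD measurableT i1 i2; apply: eq_integrable.
  apply: integrable_le i3 => // w.
  rewrite [leRHS]ger0_norm ?addr_ge0 // -?expr2 ?sqr_ge0 // ler_norml.
  by apply/andP; split; have := sqr_ge0 (f g w - 1); have := sqr_ge0 (f g w + 1); nra.
have iXS : P.-integrable setT (EFin \o (fun w => (f g w - \sum_j a j * f (v j) w) ^+ 2)).
  by apply: eq_integrable iS => // w _ /=; rewrite sumE.
rewrite expectation.unlock.
apply: le_trans (cond_expectation_best (fun j => @measurable_funPT _ _ _ _ (f (v j))) iX fhatP iXS) _.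
under eq_integral do rewrite -sumE.
rewrite ES lee_fin; apply: le_trans covK; rewrite {1 2}eE.
by rewrite (form_dot_sum matern_cov_form).
Qed.

End kriging.

Theorem corollary2 (R : realType) (d : nat) (Omega : set 'rV[R]_d) (nu : R)
  (V : set (Omega -> R)) (H : rkhs (@matern_on R d Omega nu))
  (disp : measure_display) (T : measurableType disp) (P : probability T R)
  (f : (Omega -> R) -> {RV P >-> R}) :
  (0 < d)%N ->
  compact Omega ->
  convex_set Omega ->
  (0 < lebesgue_rV d Omega)%E ->
  0 < nu ->
  V `<=` [set g : Omega -> R | continuous g] ->
  rkhs_set H `<=` V ->
  centered_gaussian_process V (@matern_cov R d Omega nu) f ->
  (exists2 C3 : R, 0 < C3 &
    forall (n : nat) (X : 'I_n -> Omega), (0 < n)%N ->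
    forall (g : Omega -> R) (fhat : T -> R), rkhs_set H g ->
      cond_expectation P (fun j => f (fun x => matern_on nu x (X j)))
        (f g) fhat ->
      ('E_P[(fun w => (f g w - fhat w) ^+ 2)%R] <=
        (C3 * rkhs_norm H g ^+ 2 * fill_distance X `^ (2 * nu))%:E)%E) /\
  (forall C' : R,
    (exists2 C : R, 0 < C &
      forall (n : nat) (X : 'I_n -> Omega), (2 <= n)%N -> quasi_uniform C' X ->
        fill_distance X <= C * n%:R `^ (- (d%:R)^-1)) /\
    (exists2 C4 : R, 0 < C4 &
      forall (n : nat) (X : 'I_n -> Omega), (2 <= n)%N -> quasi_uniform C' X ->
      forall (g : Omega -> R) (fhat : T -> R), rkhs_set H g ->
        cond_expectation P (fun j => f (fun x => matern_on nu x (X j)))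
          (f g) fhat ->
        ('E_P[(fun w => (f g w - fhat w) ^+ 2)%R] <=
          (C4 * rkhs_norm H g ^+ 2 * n%:R `^ (- (2 * nu / d%:R)))%:E)%E)).
Proof.
move=> d0 cO cvO lO nu0 Vc HV fP.
have mO := compact_measurable_rV cO.
have [D D0 OD] := compact_coord_bounded cO.
have [c [rho rho0 cube]] := convex_cube cvO mO lO.
have [Cp Cp0 hCp] := power_function_bound nu0 D0 OD cvO rho0 cube.
pose vol := fine (lebesgue_rV d Omega).
(* [Cp] is only known to be nonnegative; adding 1 makes the constant positive. *)
pose C3 := Cp * vol ^+ 2 + 1.
have C30 : 0 < C3 by rewrite ltr_wpDl // mulr_ge0 ?sqr_ge0.
have main n (X : 'I_n -> Omega) : (0 < n)%N ->
    forall (g : Omega -> R) (fhat : T -> R), rkhs_set H g ->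
      cond_expectation P (fun j => f (fun x => matern_on nu x (X j)))
        (f g) fhat ->
      ('E_P[(fun w => (f g w - fhat w) ^+ 2)%R] <=
        (C3 * rkhs_norm H g ^+ 2 * fill_distance X `^ (2 * nu))%:E)%E.
  move=> n0 g fhat Sg fhatP.
  have Q0 : 0 <= Cp * fill_distance X `^ (2 * nu) by rewrite mulr_ge0 ?powR_ge0.
  apply: le_trans (kriging_error cO nu0 Vc HV fP Q0 Sg (fun x => hCp n X x n0) fhatP) _.
  rewrite lee_fin -/vol /C3; set q := _ `^ _; set N := rkhs_norm H g ^+ 2.
  have : 0 <= N * q by rewrite mulr_ge0 ?sqr_ge0 ?powR_ge0.
  nra.
split; first by exists C3 => // n X; exact: main.
move=> C'; have [C C0 hC] := quasi_uniform_fill_distance D0 OD C' d0.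
split; first by exists C => //.
exists (C3 * C `^ (2 * nu)); first by rewrite mulr_gt0 ?powR_gt0.
move=> n X n2 qX g fhat Sg fhatP; have n0 : (0 < n)%N by exact: leq_trans n2.
apply: le_trans (main n X n0 g fhat Sg fhatP) _; rewrite lee_fin.
have N0 : 0 <= C3 * rkhs_norm H g ^+ 2 by rewrite mulr_ge0 ?sqr_ge0 // ltW.
have -> : C3 * C `^ (2 * nu) * rkhs_norm H g ^+ 2 * n%:R `^ (- (2 * nu / d%:R)) =
  C3 * rkhs_norm H g ^+ 2 * (C * n%:R `^ (- d%:R^-1)) `^ (2 * nu).
  rewrite powRM ?powR_ge0 ?(ltW C0) // -powRrM.
  have -> : - d%:R^-1 * (2 * nu) = - (2 * nu / d%:R) by ring.
  ring.
rewrite ler_wpM2l //; apply: ge0_ler_powR.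
- by rewrite mulr_ge0 // ltW.
- by rewrite nnegrE; apply: (fill_distance_ge0 OD X n0).
- by rewrite nnegrE mulr_ge0 ?powR_ge0 // ltW.
- exact: hC.
Qed.
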